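(* For every $\epsilon>0$ there exists $c>0$ such that the following holds. Let $n\in\mathbb{N}$ and let $\ell$ be an integer with $1<\ell<\frac{c\log n}{\log\log n}$. Suppose that $A\subseteq A_n$ is a normal subset of $A_n$ of density $\frac{|A|}{|A_n|}\ge n^{-cn^{1-1/\ell}}$. Then the $(\epsilon,L^2)$-mixing time of $A$ is at most $\ell$.
   Context: $A_n$ is the alternating group on $n$ letters. A subset $A\subseteq A_n$ is a normal subset of $A_n$ if it is closed under conjugation by elements of $A_n$. The logarithm is natural. For functions on $A_n$, $\|f\|_p=\big(\mathbb{E}_{\sigma\sim A_n}|f(\sigma)|^p\big)^{1/p}$, where $\sigma\sim A_n$ is uniformly distributed, and $f*g(\tau)=\mathbb{E}_{\sigma\sim A_n}[f(\sigma^{-1})g(\sigma\tau)]$; $f^{*\ell}$ denotes the $\ell$-fold convolution of $f$ with itself. For a nonempty $A\subseteq A_n$ put $f=\frac{|A_n|}{|A|}1_A$ (so $\|f\|_1=1$), which corresponds to the random walk on $A_n$ moving from $\sigma$ to $\tau\sigma$ with $\tau$ uniform in $A$. The $(\epsilon,L^p)$-mixing time of $A$ is the minimal $\ell$ such that $\|f^{*\ell}-1\|_p<\epsilon$. *)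

(* Defs.v *)
From mathcomp Require Import all_boot all_order all_algebra all_fingroup all_solvable.
From mathcomp Require Import reals exp.

Set Implicit Arguments.
Unset Strict Implicit.
Unset Printing Implicit Defensive.

Import Order.TTheory GRing.Theory Num.Theory.
Local Open Scope ring_scope.

(* A function on the group G is represented by a function on the ambient type
   gT; since G is closed under products and inverses, its values outside G
   never contribute to the averages below. *)
Section MixingTime.

Variables (R : realType) (gT : finGroupType) (G : {group gT}).
Implicit Types (f g : gT -> R) (A : {set gT}) (eps p : R).

Definition expectation f : R := (\sum_(s in G) f s) / #|G|%:R.

Definition lp_norm p f : R := expectation (fun s => `|f s| `^ p) `^ p^-1.

(* Permutations in MathComp compose left to right; composing right to left would
   give convolution g f, so convolution powers of a single function agree. *)
Definition convolution f g : gT -> R :=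
  fun t => expectation (fun s => f s^-1%g * g (s * t)%g).

(* Only meaningful for 0 < l: conv_power f 1 = f and
   conv_power f l.+2 = convolution f (conv_power f l.+1). *)
Definition conv_power f (l : nat) : gT -> R := iter l.-1 (convolution f) f.

Definition density A : R := #|A|%:R / #|G|%:R.

Definition normalized_indicator A : gT -> R :=
  fun s => #|G|%:R / #|A|%:R * (s \in A)%:R.

Definition mixes_at eps p A (l : nat) : Prop :=
  lp_norm p (fun s => conv_power (normalized_indicator A) l s - 1) < eps.

(* The mixing time is a partial notion, hence a relation: m is the least
   positive number of steps after which the walk has mixed. *)
Definition is_mixing_time eps p A (m : nat) : Prop :=
  [/\ (0 < m)%N, mixes_at eps p A m
    & forall k : nat, (0 < k)%N -> mixes_at eps p A k -> (m <= k)%N].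

(* Closed under conjugation by G; A need not be a subgroup. *)
Definition normal_subset A : Prop :=
  A \subset G /\ (forall a s, a \in A -> s \in G -> (a ^ s)%g \in A).

End MixingTime.

(* Main.v *)
Require Import Defs.
From mathcomp Require Import all_boot all_order all_algebra all_fingroup all_solvable.
From mathcomp Require Import all_field all_character.
From mathcomp Require Import reals sequences exp.
From mathcomp Require Import zify ring lra.

Set Implicit Arguments.
Unset Strict Implicit.
Unset Printing Implicit Defensive.

Import Order.TTheory GRing.Theory Num.Theory GroupScope.
Local Open Scope ring_scope.

(** Let G be the alternating group on n letters, f the density of one step of
the walk, and a_chi the Fourier coefficient of f on the irreducible character
chi of G, that is the mean of the conjugate of chi over A.  Since f is a class
function, convolution acts diagonally on characters, and Parseval gives
[sq_distE]: the squared L^2 distance to uniform after l steps is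
  the sum over chi <> 1 of |a_chi|^(2l) / chi(1)^(2l-2).

The irreducible characters are organised by level rather than by partitions:
chi has level d when d is the least size of a set S of letters such that chi
contains a nonzero vector invariant under the alternating group AltOn (~: S) of
the remaining letters.  The trivial character is the only one of level 0.  Four
facts then carry the proof.

- High level forces a large degree ([level_or_large]): beyond level 3m the
  degree is at least 2^m.  Restrict chi from T to T minus three letters; if this
  is always irreducible, then every 3-cycle on T, which commutes with the smaller
  group, acts as a scalar, and chi is trivial.  Otherwise some constituent has at
  most half the degree.

- There is not much room at low level ([sum_degree_sq_level]): decomposing the
  functions on the cosets of AltOn (~: S) gives at most n^(2d) for the sum of
  chi(1)^2 over level d.

- Permutations with few cycles have small characters
  ([level_char_bound]): if x has at most k cycles and chi has level d, then
  |chi(x)| <= chi(1) (3(k+d)/n)^d.  The normalized character at x is the average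
  over conjugates of x of a matrix coefficient between AltOn (~: S)-invariant
  vectors.  Exactness of the level gives linear relations which show that this
  coefficient is at most 1 / C(n-d, j) when j points of S leave S
  ([matrix_coef_bound]), and the number of d-sets of which exactly j points leave
  is small when there are few cycles ([num_misses_bound]).

- Few permutations have many cycles ([count_many_cycles]), because
  a permutation with k cycles fixes t^k of the t-colourings of the letters, while
  Burnside's formula bounds the total number of fixed colourings.

Take k about K n^(1-1/l) with K a small multiple of min(1, eps).  The part of A
with more than k cycles is negligible.  For the rest, level d <= k contributes at
most n^(2d) (6k/n)^(2ld), about (6K)^(2ld), which is the term of a geometric
series; this is where the exponent 1 - 1/l comes from.  At every other level the
normalized coefficient a_chi / chi(1) is so small, by the character bound up to
level 3m with m about n^(1-1/l) ln n and by the degree beyond it, that the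
Parseval bound |G|/|A| on the sum of |a_chi|^2 suffices. *)

(** * Averages of characters over subgroups *)

Section CharacterTheory.

Variables (gT : finGroupType) (G : {group gT}).
Implicit Types (H K L N : {group gT}) (i : Iirr G).

Definition triv_mult (L : {set gT}) (phi : gT -> algC) : algC :=
  #|L|%:R^-1 * \sum_(x in L) phi x.

Lemma triv_multE L (phi : 'CF(G)) : L \subset G ->
  triv_mult L phi = '['Res[L] phi, 1].
Proof.
move=> sLG; rewrite /triv_mult cfdotE; congr (_ * _).
by apply: eq_bigr => x Lx; rewrite cfResE // cfun1E Lx rmorph1 mulr1.
Qed.

Lemma triv_mult_char_nat L (phi : 'CF(G)) : L \subset G ->
  phi \is a character -> triv_mult L phi \in Num.nat.
Proof.
move=> sLG Nphi; rewrite triv_multE // -(irr0 L) Cnat_cfdot_char_irr //.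
exact: cfRes_char.
Qed.

Lemma triv_mult_nat L i : L \subset G -> triv_mult L 'chi_i \in Num.nat.
Proof. by move=> sLG; rewrite triv_mult_char_nat ?irr_char. Qed.

Lemma cfun_mulC (phi : 'CF(G)) x y : x \in G -> y \in G ->
  phi (x * y)%g = phi (y * x)%g.
Proof. by move=> Gx Gy; rewrite -(cfunJ phi (y * x)%g Gy) conjgE !mulgA mulVg mul1g. Qed.

Lemma sum_irr_mulV i j y :
  \sum_(x in G) 'chi[G]_i (x * y)%g * ('chi[G]_j x)^* =
    (i == j)%:R * (#|G|%:R * 'chi_i y / 'chi_i 1%g).
Proof.
have /(congr1 ( *%R #|G|%:R)) := generalized_orthogonality_relation y i j.
rewrite mulrA mulfV ?mul1r; last by rewrite pnatr_eq0 -lt0n cardG_gt0.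
move=> E; rewrite (eq_bigr (fun x => 'chi_i (x * y)%g * 'chi_j x^-1%g)).
  by rewrite E mulrCA !mulrA.
by move=> x _; rewrite irr_inv.
Qed.

Fact sum_conj_is_classfun i y :
  is_class_fun <<G>> [ffun x => (x \in G)%:R * \sum_(g in G) 'chi[G]_i (x * y ^ g)%g].
Proof.
rewrite genGid; apply: intro_class_fun => [x z Gx Gz | x /negPf->]; last by rewrite mul0r.
rewrite groupJ // Gx !mul1r (reindex_inj (mulIg z)) /=.
have Gm g : ((g * z)%g \in G) = (g \in G) by rewrite groupMr.
apply: eq_big => [g|g Gg]; first by rewrite Gm.
by rewrite conjgM -conjMg cfunJ.
Qed.
Definition sum_conj_cfun i y := Cfun 0 (sum_conj_is_classfun i y).

(** The class sum of y is central, so it acts on each irreducible representation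
as a scalar.  In terms of characters: as a function of x the left-hand side is a
class function, and its coordinates on the irreducible characters follow from the
generalized orthogonality relation. *)
Lemma sum_irr_conj i x y : x \in G -> y \in G ->
  \sum_(g in G) 'chi[G]_i (x * y ^ g)%g =
    #|G|%:R * 'chi_i x * 'chi_i y / 'chi_i 1%g.
Proof.
move=> Gx Gy; pose phi := sum_conj_cfun i y.
have phiE z : z \in G -> phi z = \sum_(g in G) 'chi[G]_i (z * y ^ g)%g.
  by move=> Gz; rewrite /phi /sum_conj_cfun cfunE Gz mul1r.
have nzG : #|G|%:R != 0 :> algC by rewrite pnatr_eq0 -lt0n cardG_gt0.
have coord j : '[phi, 'chi_j] = (i == j)%:R * (#|G|%:R * 'chi_i y / 'chi_i 1%g).
  rewrite cfdotE.
  rewrite (eq_bigr (fun z => \sum_(g in G) 'chi_i (z * y ^ g)%g * ('chi_j z)^*)); last first.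
    by move=> z Gz; rewrite phiE // mulr_suml.
  rewrite exchange_big /=.
  rewrite (eq_bigr (fun=> (i == j)%:R * (#|G|%:R * 'chi_i y / 'chi_i 1%g))); last first.
    by move=> g Gg; rewrite sum_irr_mulV cfunJ.
  by rewrite sumr_const -[X in _ * X = _]mulr_natl mulrA mulVf ?mul1r.
rewrite -phiE // [phi]cfun_sum_cfdot sum_cfunE (bigD1 i) //= big1 => [|j ne_ji].
  by rewrite addr0 cfunE coord eqxx mul1r -!mulrA; congr (_ * _); rewrite mulrA mulrC.
by rewrite cfunE coord eq_sym (negPf ne_ji) !mul0r.
Qed.

(** The average over L projects onto the L-invariant vectors, hence vanishes when
there are none.  Without representations: the L^2 norm over G of the function
g |-> \sum_(b in L) 'chi_i (b * g) is a multiple of \sum_(b in L) 'chi_i b. *)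
Lemma no_invariants_sum0 L i g : L \subset G -> g \in G ->
  triv_mult L 'chi_i = 0 -> \sum_(b in L) 'chi_i (b * g)%g = 0.
Proof.
move=> sLG Gg mL0.
have nz (K : {group gT}) : #|K|%:R != 0 :> algC by rewrite pnatr_eq0 -lt0n cardG_gt0.
have sumL0 : \sum_(b in L) 'chi_i b = 0.
  by apply/eqP; move/eqP: mL0; rewrite mulf_eq0 invr_eq0 (negPf (nz L)).
pose F g := \sum_(b in L) 'chi_i (b * g)%g.
have norm0 : \sum_(g in G) `|F g| ^+ 2 = 0.
  transitivity (\sum_(b in L) \sum_(b' in L) \sum_(g in G)
      'chi_i (b * g)%g * ('chi_i (b' * g)%g)^*).
    rewrite (eq_bigr (fun g => \sum_(b in L) \sum_(b' in L)
      'chi_i (b * g)%g * ('chi_i (b' * g)%g)^*)).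
      by rewrite exchange_big; apply: eq_bigr => b Lb; rewrite exchange_big.
    move=> h Gh; rewrite normCK /F rmorph_sum mulr_suml.
    by apply: eq_bigr => b Lb; rewrite mulr_sumr.
  rewrite exchange_big big1 // => b' Lb'.
  have Gb' := subsetP sLG _ Lb'.
  rewrite (eq_bigr (fun b => #|G|%:R * 'chi_i (b * b'^-1)%g / 'chi_i 1%g)).
    rewrite -mulr_suml -mulr_sumr.
    rewrite (reindex_inj (mulIg b')) /= (eq_bigl (mem L)) => [|b]; last first.
      by rewrite /= groupMr.
    rewrite (eq_bigr 'chi_i) => [|b _]; last by rewrite mulgK.
    by rewrite sumL0 mulr0 mul0r.
  move=> b Lb.
  have Gb := subsetP sLG _ Lb.
  have := sum_irr_mulV i i (b * b'^-1)%g; rewrite eqxx mul1r => <-.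
  rewrite [RHS](reindex_inj (mulgI b')) /=.
  apply: eq_big => [h|h Gh]; first by rewrite groupMl.
  by rewrite [in RHS]cfun_mulC ?groupM ?groupV ?mulgA ?mulgKV.
suff: `|F g| ^+ 2 == 0 by rewrite expf_eq0 /= normr_eq0 => /eqP.
move/eqP: norm0; rewrite psumr_eq0 => [/allP/(_ g)|h _].
  by rewrite mem_index_enum Gg; apply.
by rewrite exprn_ge0.
Qed.

End CharacterTheory.

(** N acts on the K-invariant vectors, and the left-hand side is the modulus of the
trace of g there, so the dimension bounds it. *)
Lemma normal_invariants_le (gT : finGroupType) (G K N : {group gT}) (i : Iirr G) g :
  K <| N -> N \subset G -> g \in N ->
  `|#|K|%:R^-1 * \sum_(a in K) 'chi[G]_i (g * a)%g| <= triv_mult K 'chi_i.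
Proof.
move=> nKN sNG Ng; have sKN := normal_sub nKN.
have [c c_ge0 resE] : exists2 c : Iirr N -> algC, forall j, 0 <= c j
    & forall x, x \in N -> 'chi_i x = \sum_j c j * 'chi_j x.
  exists (fun j => '['Res[N] 'chi_i, 'chi_j]) => [j|x Nx].
    by rewrite natr_ge0 // Cnat_cfdot_char_irr ?cfRes_char ?irr_char.
  rewrite -(cfResE 'chi_i sNG Nx) {1}['Res[N] _]cfun_sum_cfdot sum_cfunE.
  by apply: eq_bigr => j _; rewrite cfunE.
have avg (j : Iirr N) : \sum_(a in K) 'chi_j (g * a)%g =
    'chi_j g / 'chi_j 1%g * \sum_(a in K) 'chi_j a.
  have nzN : #|N|%:R != 0 :> algC by rewrite pnatr_eq0 -lt0n cardG_gt0.
  apply: (mulfI nzN); transitivity (\sum_(a in K) \sum_(h in N) 'chi_j (g * a ^ h)%g).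
    rewrite exchange_big /= mulr_natl -sumr_const; apply: eq_bigr => h Nh.
    rewrite (reindex_inj (conjg_inj h)) /=; apply: eq_big => [a|a Ka].
      by rewrite memJ_norm // (subsetP (normal_norm nKN)).
    by [].
  rewrite !mulr_sumr; apply: eq_bigr => a Ka.
  have Na := subsetP sKN _ Ka.
  by rewrite sum_irr_conj // -!mulrA; congr (_ * (_ * _)); rewrite mulrC.
rewrite (eq_bigr (fun a => \sum_j c j * 'chi_j (g * a)%g)) => [|a Ka]; last first.
  by rewrite resE // groupM // (subsetP sKN).
rewrite /triv_mult (eq_bigr (fun a => \sum_j c j * 'chi_j a) (F1 := 'chi_i)) => [|a Ka]; last first.
  by rewrite resE // (subsetP sKN).
rewrite !(exchange_big _ _ (index_enum (Iirr N))) /= !mulr_sumr.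
apply: le_trans (ler_norm_sum _ _ _) _; apply: ler_sum => j _.
rewrite -!mulr_sumr avg.
have sum_ge0 : 0 <= \sum_(a in K) 'chi_j a.
  have /natr_ge0 := triv_mult_nat j sKN; rewrite /triv_mult pmulr_rge0 // invr_gt0 ltr0n.
  exact: cardG_gt0.
rewrite !normrM normfV (ger0_norm (c_ge0 j)) (ger0_norm sum_ge0) normr_nat.
rewrite normfV (ger0_norm (ltW (irr1_gt0 j))).
apply: ler_wpM2l; first by rewrite invr_ge0 ler0n.
apply: ler_wpM2l => //.
rewrite ler_piMl // ler_pdivrMr ?irr1_gt0 // mul1r.
exact/char1_ge_norm/irr_char.
Qed.

(** * Alternating groups on subsets and their 3-cycles *)

Section Alternating.

Variable X : finType.
Implicit Types (T S : {set X}) (a b c d e i : X) (x y z g : {perm X}).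
Local Notation Alt := 'Alt_X%G.

(** The even permutations that move only points of T, as a subgroup of the whole
alternating group so that characters can be restricted along inclusions. *)
Definition AltOn T := ('C_Alt(~: T | 'P))%G.

Lemma AltOnP T x :
  reflect (~~ odd_perm x /\ forall i, i \notin T -> x i = i) (x \in AltOn T).
Proof.
rewrite inE Alt_even; apply: (iffP andP) => [[-> /astabP xT]|[-> xT]]; split=> //.
  by move=> i iT; have := xT i; rewrite inE iT; apply.
by apply/astabP => i; rewrite inE; apply: xT.
Qed.

Lemma AltOn_sub T : AltOn T \subset Alt.
Proof. exact: subsetIl. Qed.

Lemma AltOnS T S : T \subset S -> AltOn T \subset AltOn S.
Proof.
move=> sTS; apply/subsetP => x /AltOnP[ev fx]; apply/AltOnP; split=> // i iS.
by apply: fx; apply: contra iS; apply: (subsetP sTS).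
Qed.

Lemma AltOnT : AltOn setT :=: Alt.
Proof.
apply/setP => x; apply/AltOnP/idP => [[ev _]|]; rewrite Alt_even // => ev.
by split=> // i; rewrite inE.
Qed.

Lemma exists_outside T (s : seq X) : (size s < #|T|)%N ->
  exists2 u, u \in T & u \notin s.
Proof.
move=> lt_sT; apply/subsetPn/negP => sTs.
have := leq_trans (subset_leq_card sTs) (card_size s).
by rewrite leqNgt lt_sT.
Qed.

Definition cyc3 a b c := (tperm a b * tperm a c)%g.

Lemma cyc3_1 a b c : b != a -> b != c -> cyc3 a b c a = b.
Proof. by move=> ba bc; rewrite permM tpermL tpermD // eq_sym. Qed.

Lemma cyc3_2 a b c : cyc3 a b c b = c.
Proof. by rewrite permM tpermR tpermL. Qed.

Lemma cyc3_3 a b c : c != a -> c != b -> cyc3 a b c c = a.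
Proof. by move=> ca cb; rewrite permM [tperm a b c]tpermD ?tpermR // eq_sym. Qed.

Lemma cyc3_D a b c i : i != a -> i != b -> i != c -> cyc3 a b c i = i.
Proof. by move=> ia ib ic; rewrite permM !tpermD // eq_sym. Qed.

Lemma cyc3_AltOn T a b c : a \in T -> b \in T -> c \in T ->
  b != a -> c != a -> cyc3 a b c \in AltOn T.
Proof.
move=> aT bT cT ba ca; apply/AltOnP; split.
  by rewrite odd_permM !odd_tperm eq_sym ba eq_sym ca.
move=> i iT; apply: cyc3_D; apply: contraNneq iT => -> //.
Qed.

Lemma cyc3J a b c g : (cyc3 a b c ^ g)%g = cyc3 (g a) (g b) (g c).
Proof. by rewrite conjMg !tpermJ. Qed.

(** Multiplying a nontrivial even permutation by a 3-cycle on points that it moves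
produces a new fixed point and no new moved point. *)
Lemma AltOn_gen T (N : {group {perm X}}) :
  (forall a b c, a \in T -> b \in T -> c \in T -> b != a -> c != a -> c != b ->
     cyc3 a b c \in N) ->
  AltOn T \subset N.
Proof.
move=> cycN; apply/subsetP => x.
have [m] := ubnP #|[set i | x i != i]|.
elim: m x => // m IHm x lt_xm /AltOnP[ev fx].
have [/existsP[a xa]|/existsPn x1] := boolP [exists a, x a != a]; last first.
  suff -> : x = 1%g by exact: group1.
  by apply/permP => i; rewrite perm1; apply/eqP; have := x1 i; rewrite negbK.
have movT i : x i != i -> i \in T.
  by apply: contraR => /fx ->.
set b := x a in xa.
have xb : x b != b by apply: contraNneq xa => /perm_inj <-.
have [c xc /andP[ca cb]] : exists2 c, x c != c & (c != a) && (c != b).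
  apply/exists_inP; apply: contraR ev => /exists_inPn nc.
  (* A permutation moving at most two points is odd or trivial. *)
  suff -> : x = tperm a b by rewrite odd_tperm eq_sym.
  have fix_i i : i != a -> i != b -> x i = i.
    move=> ia ib; apply/eqP; apply: contraT => xi.
    by have := nc i xi; rewrite ia ib.
  apply/permP => i; case: tpermP => [->|->|/eqP ia /eqP ib] //; last exact: fix_i.
  apply/eqP; apply: contraT => xba.
  have /perm_inj/eqP := fix_i (x b) xba xb; by rewrite (negPf xb).
have ba : b != a by [].
have [aT bT cT] : [/\ a \in T, b \in T & c \in T] by split; apply: movT.
pose t := cyc3 b a c.
have Nt : t \in N by apply: cycN => //; rewrite eq_sym.
suff : (x * t)%g \in N by rewrite groupMr.
have tT : t \in AltOn T by apply: cyc3_AltOn => //; rewrite eq_sym.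
apply: IHm; last first.
  by rewrite groupM //; apply/AltOnP.
rewrite -ltnS; apply: leq_trans lt_xm; apply: proper_card; apply/properP; split.
  apply/subsetP => i; rewrite !inE; apply: contra => /eqP xi.
  rewrite permM xi cyc3_D //; apply/eqP => E; rewrite E in xi.
  - by rewrite xi eqxx in xb.
  - by rewrite -/b in xi; rewrite xi eqxx in xa.
  - by rewrite xi eqxx in xc.
exists a; first by rewrite inE.
by rewrite inE negbK permM -/b cyc3_1 // eq_sym.
Qed.

(** This makes linear characters trivial on 3-cycles. *)
Lemma cyc3_commutator a b c d e : uniq [:: a; b; c; d; e] ->
  cyc3 a b c = ((cyc3 a d b)^-1 * cyc3 a d b ^ cyc3 b c e)%g.
Proof.
rewrite /= !inE !negb_or => /and5P[/and4P[ab ac ad ae] /and3P[bc bd be] /andP[cd ce] de _].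
have [ba ca da cb db] : [/\ b != a, c != a, d != a, c != b & d != b].
  by split; rewrite eq_sym.
have [dc eb ec] : [/\ d != c, e != b & e != c] by split; rewrite eq_sym.
have s1 : (cyc3 a d b ^ cyc3 b c e)%g = cyc3 a d c.
  by rewrite cyc3J cyc3_1 ?cyc3_D //.
have sK : ((cyc3 a d b)^-1 = cyc3 b d a)%g.
  apply/eqP; rewrite eq_invg_mul; apply/eqP/permP => i; rewrite perm1 permM.
  have [->|ia] := eqVneq i a; first by rewrite cyc3_1 ?cyc3_2 //.
  have [->|id] := eqVneq i d; first by rewrite cyc3_2 cyc3_1 //.
  have [->|ib] := eqVneq i b; first by rewrite !cyc3_3 //.
  by rewrite !cyc3_D.
rewrite s1 sK; apply/permP => i; rewrite [RHS]permM.
have [->|ia] := eqVneq i a.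
  by rewrite cyc3_1 ?cyc3_3 ?cyc3_D //.
have [->|ib] := eqVneq i b.
  by rewrite cyc3_2 cyc3_1 ?cyc3_2 //.
have [->|ic] := eqVneq i c.
  by rewrite cyc3_3 // [cyc3 b d a c]cyc3_D // cyc3_3.
have [->|id] := eqVneq i d.
  by rewrite cyc3_2 cyc3_1 ?cyc3_D //.
by rewrite !cyc3_D.
Qed.

End Alternating.

(** * Irreducible characters of small degree have invariants *)

(** Of two irreducible summands, the one of smaller degree has at most half of the
total degree. *)
Lemma reducible_constt (gT : finGroupType) (K : {group gT}) (phi : 'CF(K)) :
  phi \is a character -> phi != 0 -> phi \notin irr K ->
  exists2 j : Iirr K, phi - 'chi_j \is a character & 'chi_j 1%g *+ 2 <= phi 1%g.
Proof.
move=> Nphi nz_phi red.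
have [j jphi] := neq0_has_constt nz_phi.
have Npsi : phi - 'chi_j \is a character.
  have [psi Npsi ->] := constt_charP j Nphi jphi.
  by rewrite addrAC subrr add0r.
have nz_psi : phi - 'chi_j != 0.
  by apply: contraNneq red => /subr0_eq ->; exact: mem_irr.
have [j' j'psi] := neq0_has_constt nz_psi.
have [psi Npsi' E] := constt_charP j' Npsi j'psi.
have phiE : phi = 'chi_j + 'chi_j' + psi by rewrite -addrA -E addrC subrK.
have phi1 : phi 1%g = 'chi_j 1%g + 'chi_j' 1%g + psi 1%g by rewrite phiE !cfunE.
have psi1 : 0 <= psi 1%g by rewrite char1_ge0.
have le2 (u v : algC) : u <= v -> u *+ 2 <= u + v + psi 1%g.
  by move=> uv; rewrite mulr2n -[leLHS]addr0 lerD // lerD2l.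
have realj (k : Iirr K) : 'chi_k 1%g \is Num.real.
  by rewrite ger0_real // ltW ?irr1_gt0.
have [le|lt] := real_leP (realj j) (realj j').
  by exists j => //; rewrite phi1 le2.
exists j'; last by rewrite phi1 [X in X + _]addrC le2 // ltW.
by rewrite phiE addrAC addrK rpredD ?irr_char.
Qed.

Section DegreeBound.

Variable X : finType.
Implicit Types (T S : {set X}) (a b c d e i : X) (x y z g : {perm X}).
Implicit Types H : {group {perm X}}.

(** The 3-cycle commutes with the group on the remaining points; when that group
acts irreducibly, Schur's lemma makes the 3-cycle act as a scalar. *)
Lemma cyc3_cfcenter T H (i : Iirr H) a b c : H :=: AltOn T ->
  a \in T -> b \in T -> c \in T -> b != a -> c != a -> c != b ->
  'Res[AltOn (T :\: [set a; b; c])] 'chi_i \in irr (AltOn (T :\: [set a; b; c])) ->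
  cyc3 a b c \in 'Z('chi_i)%CF.
Proof.
move=> defH aT bT cT ba ca cb.
set K := AltOn _ => irrK; set z := cyc3 a b c.
have zH : z \in H by rewrite defH cyc3_AltOn.
have sKH : K \subset H by rewrite defH AltOnS // subsetDl.
pose L := (K <*> <[z]>)%G.
have sLH : L \subset H by rewrite join_subG sKH cycle_subG.
have sKL : K \subset L := joing_subl _ _.
have zL : z \in L by rewrite (subsetP (joing_subr _ _)) ?cycle_id.
have /irrP[j Ej] : 'Res[L] 'chi_i \in irr L.
  apply: (@cfRes_irr_irr _ _ K); first by rewrite cfRes_char ?irr_char.
  by rewrite cfResRes.
have zZ : z \in 'Z(L).
  apply/centerP; split=> // y Ly; apply: commute_sym; apply/cent1P.
  suff: L \subset 'C[z] by move/subsetP; apply.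
  rewrite join_subG cycle_subG cent1id andbT.
  apply/subsetP => x /AltOnP[_ fx]; apply/cent1P; rewrite /commute.
  have fxa u : u \in [set a; b; c] -> x u = u by move=> uS; rewrite fx // inE uS.
  have [fa fb fc] : [/\ x a = a, x b = b & x c = c].
    by split; apply: fxa; rewrite !inE eqxx ?orbT.
  by rewrite [(z * x)%g]conjgC cyc3J fa fb fc.
have /bigcapP/(_ j isT) : z \in \bigcap_k 'Z('chi[L]_k)%CF by rewrite cap_cfcenter_irr.
by rewrite !irr_cfcenterE // -Ej !cfResE.
Qed.

(** If all 3-cycles act as scalars then so does the group that they generate, so
'chi_i is linear; and a 3-cycle is a commutator. *)
Lemma all_cyc3_cfcenter T H (i : Iirr H) : H :=: AltOn T -> (4 < #|T|)%N ->
  (forall a b c, a \in T -> b \in T -> c \in T -> b != a -> c != a -> c != b ->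
     cyc3 a b c \in 'Z('chi_i)%CF) ->
  i = 0.
Proof.
move=> defH T5 cycZ.
have ZH x : x \in H -> `|'chi_i x| = 'chi_i 1%g.
  move=> Hx; apply/eqP; rewrite -irr_cfcenterE //.
  have : AltOn T \subset cfcenter_group 'chi_i by exact: AltOn_gen.
  by move/subsetP; apply; rewrite -defH.
have lin_i : 'chi_i \is a linear_char.
  rewrite qualifE /= irr_char /=.
  have : '['chi_i] = 1 by rewrite cfnorm_irr.
  rewrite cfdotE (eq_bigr (fun=> 'chi_i 1%g ^+ 2)) => [|x Hx]; last by rewrite -normCK ZH.
  rewrite sumr_const -[X in _ * X = _]mulr_natl mulKf ?pnatr_eq0 -?lt0n ?cardG_gt0 //.
  by move/eqP; rewrite sqrp_eq1 // ltW ?irr1_gt0.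
have kerH : AltOn T \subset cfker_group 'chi_i.
  apply: AltOn_gen => a b c aT bT cT ba ca cb.
  have [d dT dn] := @exists_outside _ T [:: a; b; c] (ltn_trans (isT : (3 < 4)%N) T5).
  have [e eT en] := @exists_outside _ T [:: a; b; c; d] T5.
  move: dn en; rewrite !inE !negb_or => /and3P[da db dc] /and4P[ea eb ec ed].
  have U : uniq [:: a; b; c; d; e].
    rewrite /= !inE !negb_or ![a == _]eq_sym ba ca da ea.
    by rewrite ![b == _]eq_sym cb db eb ![c == _]eq_sym dc ec eq_sym ed.
  have sH : cyc3 a d b \in H by rewrite defH cyc3_AltOn.
  have tH : cyc3 b c e \in H by rewrite defH cyc3_AltOn.
  suff: cyc3 a b c \in cfker 'chi_i by rewrite inE.
  rewrite cfkerEchar ?irr_char // inE (cyc3_commutator U) groupM ?groupJ ?groupV //=.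
  rewrite lin_charM ?groupJ ?groupV // lin_charV // cfunJ //.
  by rewrite mulVf ?lin_char_neq0 // lin_char1.
apply: irr_inj; rewrite irr0; apply/cfun_inP => x Hx.
have : x \in cfker 'chi_i by move/subsetP: kerH; apply; rewrite -defH.
by rewrite cfkerEchar ?irr_char // inE Hx /= cfun1E Hx => /eqP->; rewrite lin_char1.
Qed.

(** As long as the character is nontrivial, three points can be chosen such that
the restriction to the complement splits; pass to a constituent of at most half the
degree.  The degree being less than 2 ^ m, the trivial character is reached within
m such steps. *)
Lemma small_degree_invariants m T H (i : Iirr H) : H :=: AltOn T ->
  (3 * m + 2 <= #|T|)%N -> 'chi_i 1%g < 2 ^+ m ->
  exists T', [/\ T' \subset T, #|T'| = (#|T| - 3 * m)%N
               & triv_mult (AltOn T') 'chi_i != 0].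
Proof.
elim: m T H i => [|m IHm] T H i defH leT.
  have /natrP[k E] := Cnat_irr1 i.
  by rewrite expr0 E ltrn1; have := irr1_gt0 i; rewrite E ltr0n; case: (k).
move=> lt_deg.
have [->|nz_i] := eqVneq i 0.
  have : (#|T| - 3 * m.+1 <= #|T|)%N by exact: leq_subr.
  have [s [us ss sz]] : exists s : seq X, [/\ uniq s, {subset s <= T} &
     size s = (#|T| - 3 * m.+1)%N].
    exists (take (#|T| - 3 * m.+1) (enum T)); split.
    - exact/take_uniq/enum_uniq.
    - by move=> u /mem_take; rewrite mem_enum.
    by rewrite size_takel // -cardE leq_subr.
  exists [set u in s]; split.
  - by apply/subsetP => u; rewrite inE => /ss.
  - by rewrite cardsE (card_uniqP us).
  rewrite /triv_mult (eq_bigr (fun=> 1)) => [|x xT].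
    by rewrite sumr_const mulVf ?oner_neq0 // pnatr_eq0 -lt0n cardG_gt0.
  have: x \in H.
    rewrite defH; apply: subsetP xT; apply: AltOnS.
    by apply/subsetP => u; rewrite inE => /ss.
  by rewrite irr0 cfun1E => ->.
have /existsP[a /existsP[b /existsP[c /and4P[aT bT cT /and4P[ba ca cb nZ]]]]] :
  [exists a, exists b, exists c, [&& a \in T, b \in T, c \in T &
    [&& b != a, c != a, c != b & cyc3 a b c \notin 'Z('chi_i)%CF]]].
  apply: contraNT nz_i => /existsPn nex; apply/eqP.
  apply: (all_cyc3_cfcenter defH) => [|a b c aT bT cT ba ca cb].
    by lia.
  have /existsPn/(_ b)/existsPn/(_ c) := nex a.
  by rewrite aT bT cT ba ca cb /= negbK.
pose T1 := T :\: [set a; b; c]; pose K := AltOn T1.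
have sKH : K \subset H by rewrite defH AltOnS // subsetDl.
have cT1 : #|T1| = (#|T| - 3)%N.
  have c3 : #|[set a; b; c]| = 3.
    by rewrite setUC cardsU1 cards2 !inE negb_or ca cb eq_sym ba.
  rewrite cardsD (setIidPr _) ?c3 //.
  by apply/subsetP => u; rewrite !inE => /orP[/orP[]|] /eqP->.
have leT1 : (3 * m + 2 <= #|T1|)%N by rewrite cT1; clear -leT; lia.
have redK : 'Res[K] 'chi_i \notin irr K.
  by apply: contra nZ => /(cyc3_cfcenter defH aT bT cT ba ca cb).
have Nres : 'Res[K] 'chi_i \is a character by rewrite cfRes_char ?irr_char.
have [j Npsi le2] := reducible_constt Nres (Res_irr_neq0 _ _) redK.
have [] := IHm T1 K j.
- by [].
- exact: leT1.
- have r1 : ('Res[K] 'chi_i) 1%g = 'chi_i 1%g := cfRes1 _ _.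
  have two_gt0 : 0 < 2%:R :> algC by rewrite ltr0n.
  rewrite -(ltr_pM2l two_gt0) -exprS; apply: le_lt_trans lt_deg.
  by rewrite mulr_natl -r1.
move=> T' [sT' cT' mT']; exists T'; split.
- by apply: subset_trans sT' (subsetDl _ _).
- by rewrite cT' cT1 mulnS subnDA.
have sT'K : AltOn T' \subset K by exact: AltOnS.
have mE : triv_mult (AltOn T') 'chi_i = triv_mult (AltOn T') 'chi_j +
    triv_mult (AltOn T') ('Res[K] 'chi_i - 'chi_j).
  rewrite /triv_mult -mulrDr -big_split; congr (_ * _); apply: eq_bigr => x xT'.
  by rewrite !cfunE cfResE ?(subsetP sT'K) //= addrC subrK.
rewrite mE; have := natr_ge0 (triv_mult_char_nat sT'K Npsi).
have: 0 < triv_mult (AltOn T') 'chi_j.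
  by rewrite lt0r mT' natr_ge0 // triv_mult_nat.
by move=> m1 m2; rewrite gt_eqF // ltr_wpDr.
Qed.

End DegreeBound.

(** * Matrix coefficients of invariant vectors *)

Section MatrixCoefficient.

Variable X : finType.
Local Notation Alt := 'Alt_X%G.
Variables (S : {set X}) (i : Iirr Alt).
Implicit Types (a b x y z g : {perm X}).

Definition misses (S : {set X}) g := #|[set s in S | g s \notin S]|.

Local Notation K := (AltOn (~: S)).

(** The trace of g followed by the projection onto the K-invariant vectors. *)
Definition matrix_coef g : algC := #|K|%:R^-1 * \sum_(a in K) 'chi_i (g * a)%g.

Lemma matrix_coefMr a g : a \in K -> matrix_coef (g * a)%g = matrix_coef g.
Proof.
move=> Ka; congr (_ * _); rewrite [RHS](reindex_inj (mulgI a)) /=.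
by apply: eq_big => [b|b _]; rewrite ?groupMl // mulgA.
Qed.

Lemma matrix_coefMl a g : a \in K -> g \in Alt -> matrix_coef (a * g)%g = matrix_coef g.
Proof.
move=> Ka Gg; have sKG := AltOn_sub (~: S); have Ga := subsetP sKG _ Ka.
congr (_ * _); rewrite [RHS](reindex_inj (mulIg a)) /=.
apply: eq_big => [b|b Kb]; first by rewrite groupMr.
by rewrite -mulgA cfun_mulC ?groupM ?(subsetP sKG _ Kb) // mulgA.
Qed.

Lemma AltOn_fix T a u : a \in AltOn T -> u \notin T -> a u = u.
Proof. by case/AltOnP => _; apply. Qed.

Hypothesis S_small : (2 * #|S| + 2 <= #|X|)%N.
Hypothesis level : forall T : {set X}, #|T| = (#|X| - #|S|).+1 ->
  triv_mult (AltOn T) 'chi_i = 0.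

Let m := triv_mult K 'chi_i.

Lemma matrix_coef_bound0 g : g \in Alt -> misses S g = 0 -> `|matrix_coef g| <= m.
Proof.
move=> Gg /eqP; rewrite cards_eq0 => /eqP m0.
have gS s : s \in S -> g s \in S.
  by move=> sS; apply: contraFT (in_set0 s) => gs; rewrite -m0 inE sS.
pose N := ('N_Alt(S | 'P))%G.
have Ng : g \in N.
  rewrite inE Gg; apply/astabsP => s; apply/idP/idP => [gsS|/gS //].
  have <- : g @^-1: S = S.
    apply/esym/eqP; rewrite eqEcard card_preimset ?leqnn ?andbT; last exact: perm_inj.
    by apply/subsetP => v vS; rewrite inE gS.
  by rewrite inE.
apply: (normal_invariants_le (N := N)) => //; last exact: subsetIl.
have -> : (K = N :&: 'C(S | 'P) :> {set _})%g.
  by rewrite /= setCK -setIA (setIidPr (normal_sub (astab_normal _ _))).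
by apply: normalGI (astab_normal _ _); exact: subsetIr.
Qed.

Lemma misses_shift (u : X) b g : u \in S -> g u \notin S ->
  b \in AltOn (u |: ~: S) -> g (b u) \in S ->
  (misses S (b * g)%g).+1 = misses S g.
Proof.
move=> uS gu Lb gbu; rewrite [RHS](cardsD1 u) inE uS gu add1n; congr _.+1.
apply: eq_card => s; rewrite !inE permM.
have [->|su] /= := eqVneq s u; first by rewrite gbu andbF.
by case: (boolP (s \in S)) => //= sS; rewrite (AltOn_fix Lb) // !inE negb_or su sS.
Qed.

(** Up to an element of K on its left, b is a 3-cycle through u, b u and a point
v such that neither v nor g v lies in S.  Conjugating this 3-cycle by g moves it
to the right of g, where it is supported outside S and so belongs to K as well. *)
Lemma matrix_coef_shift (u : X) b g : g \in Alt -> u \in S -> g u \notin S ->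
  b \in AltOn (u |: ~: S) -> g (b u) \notin S -> matrix_coef (b * g)%g = matrix_coef g.
Proof.
move=> Gg uS gu Lb gbu.
have [bu|bu] := eqVneq (b u) u.
  apply: matrix_coefMl => //; apply/AltOnP; split; first by case/AltOnP: Lb.
  move=> s; rewrite inE negbK => sS; have [->//|su] := eqVneq s u.
  by apply: (AltOn_fix Lb); rewrite !inE negb_or su negbK.
have buS : b u \notin S.
  apply/negP => buS; have bT : b u \notin u |: ~: S by rewrite !inE negb_or bu negbK.
  by have /perm_inj/eqP := AltOn_fix Lb bT; rewrite (negPf bu).
have [v] : exists2 v, v \in ~: (S :|: g @^-1: S) & v \notin [:: b u].
  apply: exists_outside => /=.
  have := cardsC (S :|: g @^-1: S); have := leq_of_leqif (leq_card_setU S (g @^-1: S)).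
  rewrite card_preimset; last exact: perm_inj.
  by move: S_small; clear; lia.
rewrite !inE negb_or => /andP[vS gv] vbu.
have uv : v != u by apply: contraNneq vS => ->.
pose t := cyc3 u (b u) v.
have tu : t u = b u by rewrite cyc3_1 // eq_sym.
have Lt : t \in AltOn (u |: ~: S).
  by apply: cyc3_AltOn; rewrite ?inE ?eqxx ?buS ?vS ?orbT.
have Kbt : (b * t^-1)%g \in K.
  apply/AltOnP; split.
    have : (b * t^-1)%g \in AltOn (u |: ~: S) by rewrite groupM ?groupV.
    by case/AltOnP.
  move=> s; rewrite inE negbK permM => sS; apply: (@perm_inj _ t); rewrite permKV.
  have [->|su] := eqVneq s u; first by rewrite tu.
  by rewrite !(AltOn_fix Lb, AltOn_fix Lt) // !inE negb_or su negbK.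
have Gt : t \in Alt by apply: (subsetP (AltOn_sub _)) Lt.
have -> : (b * g = b * t^-1 * (t * g))%g by rewrite mulgA mulgKV.
rewrite (matrix_coefMl Kbt) //; last exact: groupM.
rewrite (conjgC t g) matrix_coefMr //.
by rewrite cyc3J cyc3_AltOn ?inE // (inj_eq perm_inj).
Qed.

(** The permutations of AltOn (u |: ~: S) that send u to v form a coset of K. *)
Lemma card_move (u v : X) : u \in S -> v \in u |: ~: S ->
  #|[set b in AltOn (u |: ~: S) | b u == v]| = #|K|.
Proof.
move=> uS vT.
have [t Lt tu] : exists2 t, t \in AltOn (u |: ~: S) & t u = v.
  have [->|vu] := eqVneq v u; first by exists 1%g; rewrite ?group1 ?perm1.
  have [w wT] : exists2 w, w \in u |: ~: S & w \notin [:: u; v].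
    apply: exists_outside; rewrite cardsU1 !inE uS /=; have := cardsC S.
    by move: S_small; clear; lia.
  rewrite !inE negb_or => /andP[wu wv].
  exists (cyc3 u v w); last by rewrite cyc3_1 // eq_sym.
  by apply: cyc3_AltOn; rewrite // ?inE ?eqxx.
rewrite -(card_rcoset K t); apply: eq_card => b; rewrite mem_rcoset inE.
apply/andP/AltOnP => [[Lb /eqP bu]|[ev fx]].
  have : (b * t^-1)%g \in AltOn (u |: ~: S) by rewrite groupM ?groupV.
  case/AltOnP=> ev fx; split=> // s; rewrite inE negbK permM => sS.
  apply: (@perm_inj _ t); rewrite permKV.
  have [->|su] := eqVneq s u; first by rewrite tu.
  by rewrite !(AltOn_fix Lb, AltOn_fix Lt) // !inE negb_or su negbK.
have KL : (b * t^-1)%g \in AltOn (u |: ~: S).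
  by apply/AltOnP; split=> // s sT; apply: fx; apply: contra sT; rewrite !inE orbC => ->.
split; first by rewrite -[b](mulgKV t) groupM.
by rewrite -[b](mulgKV t) permM fx ?tu // inE uS.
Qed.

(** Induction on the number of points leaving S.  Let u be such a point.  There is
no vector invariant under AltOn (u |: ~: S), so the coefficients of b * g sum to
zero over b in this group.  When g (b u) is outside S the coefficient is that of g;
otherwise one point fewer leaves S and induction applies.  When j + 1 points leave
S, the two cases occur for n - d - j and j + 1 values of b u, where n and d are the
sizes of X and S, and the ratio of these numbers is that of consecutive binomial
coefficients. *)
Lemma matrix_coef_bound g : g \in Alt ->
  `|matrix_coef g| * 'C(#|X| - #|S|, misses S g)%:R <= m.
Proof.
move: {2}(misses S g) (erefl (misses S g)) => j; elim: j g => [|j IHj] g Eg Gg.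
  by rewrite Eg bin0 mulr1 matrix_coef_bound0.
have [u uS gu] : exists2 u, u \in S & g u \notin S.
  have /card_gt0P[u] : (0 < misses S g)%N by rewrite Eg.
  by rewrite inE => /andP[]; exists u.
pose T := u |: ~: S; pose L := AltOn T.
have cardT : #|T| = (#|X| - #|S|).+1.
  by rewrite cardsU1 !inE uS /= cardsCs setCK.
have sum0 : \sum_(b in L) matrix_coef (b * g)%g = 0.
  rewrite -mulr_sumr exchange_big /= big1 ?mulr0 // => a Ka.
  have Ga := subsetP (AltOn_sub _) _ Ka.
  rewrite (eq_bigr (fun b => 'chi_i (b * (g * a))%g)) => [|b _]; last by rewrite mulgA.
  by apply: no_invariants_sum0; rewrite ?groupM ?AltOn_sub ?level.
have count (P : pred X) : (\sum_(b in L | P (b u)) 1 = #|K| * #|[set v in T | P v]|)%N.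
  rewrite (partition_big (fun b => b u) (mem [set v in T | P v])) /=; last first.
    move=> b /andP[Lb Pb]; rewrite inE Pb andbT; apply: contraT => bT.
    have := AltOn_fix Lb bT => /perm_inj E; by rewrite E !inE eqxx in bT.
  rewrite (eq_bigr (fun=> #|K|)) => [|v]; first by rewrite sum_nat_const mulnC.
  rewrite inE => /andP[vT Pv]; rewrite -(card_move uS vT) -sum1_card.
  by apply: eq_bigl => b; rewrite inE -andbA; case: eqP => [->|]; rewrite ?Pv ?andbF ?andbT.
have cardB : #|[set v in T | g v \in S]| = j.+1.
  have -> : [set v in T | g v \in S] = g @^-1: S :\: S.
    apply/setP => v; rewrite !inE; case: eqVneq => [->|_] //=.
    by rewrite (negPf gu) andbF.
  have := cardsID S (g @^-1: S); rewrite card_preimset; last exact: perm_inj.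
  have := cardsID (g @^-1: S) S; rewrite setIC.
  have <- : misses S g = #|S :\: g @^-1: S|.
    by apply: eq_card => s; rewrite !inE andbC.
  by rewrite Eg; move: #|_ :&: _| #|_ :\: _| #|S| => p q r; clear; lia.
have cardA : #|[set v in T | g v \notin S]| = (#|X| - #|S| - j)%N.
  have := cardsID [set v | g v \in S] T; rewrite cardT.
  have -> : T :&: [set v | g v \in S] = [set v in T | g v \in S].
    by apply/setP => v; rewrite !inE.
  have -> : T :\: [set v | g v \in S] = [set v in T | g v \notin S].
    by apply/setP => v; rewrite !inE andbC.
  by rewrite cardB; move: #|X| #|S| #|_| => p q r; clear; lia.
have cA := count (fun v => g v \notin S); have cB := count (fun v => g v \in S).
rewrite /= in cA cB.
have K_gt0 : 0 < #|K|%:R :> algC by rewrite ltr0n cardG_gt0.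
have key : `|matrix_coef g| * (#|X| - #|S| - j)%:R * 'C(#|X| - #|S|, j)%:R <= j.+1%:R * m.
  rewrite -(ler_pM2l K_gt0).
  have -> : #|K|%:R * (`|matrix_coef g| * (#|X| - #|S| - j)%:R * 'C(#|X| - #|S|, j)%:R) =
     `|\sum_(b in L | g (b u) \in S) matrix_coef (b * g)%g| * 'C(#|X| - #|S|, j)%:R.
    move/eqP: sum0; rewrite (bigID (fun b : {perm X} => g (b u) \in S)) /= addr_eq0 => /eqP->.
    rewrite normrN (eq_bigr (fun=> matrix_coef g * 1%:R)) => [|b /andP[Lb gb]]; last first.
      by rewrite mulr1; apply: matrix_coef_shift Lb gb.
    rewrite -mulr_sumr -natr_sum cA cardA; move: (matrix_coef g) => cg.
    rewrite normrM normr_nat natrM !mulrA.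
    by rewrite [_%:R * `|_|]mulrC.
  apply: le_trans (ler_wpM2r (ler0n _ _) (ler_norm_sum _ _ _)) _.
  rewrite mulr_suml mulrA -natrM -cardB -cB natr_sum mulr_suml.
  apply: ler_sum => b /andP[Lb gb]; rewrite mul1r.
  have := misses_shift uS gu Lb gb; rewrite Eg => -[Ej].
  by rewrite -Ej IHj // groupM // (subsetP (AltOn_sub _) _ Lb).
have j_gt0 : 0 < j.+1%:R :> algC by rewrite ltr0n.
rewrite Eg -(ler_pM2l j_gt0) mulrCA -natrM mul_bin_left natrM mulrA.
exact: key.
Qed.

End MatrixCoefficient.

(** * Subsets nearly stable under a permutation *)

Section CountMisses.

Local Open Scope nat_scope.

Variable X : finType.
Implicit Types (S T : {set X}) (x y z g : {perm X}) (d j k : nat).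

Definition num_misses x d j := #|[set S : {set X} | (#|S| == d) && (misses S x == j)]|.

Lemma card_dep_pairs (A B : finType) (P : {set A}) (Q : A -> {set B}) :
  #|[set p : A * B | (p.1 \in P) && (p.2 \in Q p.1)]| = \sum_(a in P) #|Q a|.
Proof.
under eq_bigr do rewrite -sum1_card.
by rewrite pair_big_dep -sum1_card; apply: eq_bigl => p; rewrite inE.
Qed.

Lemma misses_remove S x b : b \in S -> x b \notin S ->
  misses (S :\ b) x + (b \notin [set x s | s in S]) = misses S x.
Proof.
move=> bS xb; have xbb : x b != b by apply: contraNneq xb => ->.
pose b' := (x^-1 b)%g; have xb' : x b' = b by rewrite permKV.
have b'b : b' != b by apply: contraNneq xbb => E; rewrite -{1}E xb'.
rewrite /misses [RHS](cardsD1 b) inE bS xb /=.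
have imb : (b \in [set x s | s in S]) = (b' \in S).
  by rewrite -{1}xb' (mem_imset _ _ (@perm_inj _ x)).
rewrite imb; case: (boolP (b' \in S)) => b'S /=; last first.
  rewrite addn1 add1n; congr _.+1; apply: eq_card => s; rewrite !inE.
  case: (eqVneq s b) => //= sb; case: (boolP (s \in S)) => //= sS.
  suff -> : x s != b by [].
  by apply: contraNneq b'S => E; rewrite /b' -E permK.
rewrite addn0 (cardsD1 b') !inE b'b b'S xb' eqxx /=; congr _.+1.
apply: eq_card => s; rewrite !inE.
case: (eqVneq s b') => [->|sb'] /=; first by rewrite xb' bS !andbF.
case: (eqVneq s b) => //= sb; case: (boolP (s \in S)) => //= sS.
suff -> : x s != b by [].
by apply: contraNneq sb' => E; rewrite /b' -E permK.
Qed.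

(** Count the sets S of size d + 1 with j + 1 leaving points and one of these, b, by
removing b.  If the point mapped to b is in S, it becomes a leaving point in place of b;
otherwise the number of leaving points drops, and b is any point of X. *)
Lemma num_misses_rec x d j :
  j.+1 * num_misses x d.+1 j.+1 <=
    j.+1 * num_misses x d j.+1 + #|X| * num_misses x d j.
Proof.
pose lev d j := [set S : {set X} | (#|S| == d) && (misses S x == j)].
pose ends S := [set s in S | x s \notin S].
have pairs d' : j.+1 * num_misses x d' j.+1 =
    #|[set p : {set X} * X | (p.1 \in lev d' j.+1) && (p.2 \in ends p.1)]|.
  rewrite card_dep_pairs (eq_bigr (fun=> j.+1)) ?sum_nat_const 1?mulnC // => S.
  by rewrite inE => /andP[_ /eqP].
rewrite pairs -(cardsID [set p : {set X} * X | p.2 \in x @: p.1]).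
apply: leq_add.
  rewrite pairs; set P := _ :&: _.
  pose f (p : {set X} * X) := (p.1 :\ p.2, x^-1 p.2)%g.
  have injf : {in P &, injective f}.
    move=> [S b] [S' b']; rewrite !inE /= => /andP[/andP[_ /andP[bS _]] _].
    move=> /andP[/andP[_ /andP[bS' _]] _] [E /perm_inj E'].
    by rewrite -(setD1K bS) -(setD1K bS') E E'.
  rewrite -(card_in_imset injf); apply/subset_leq_card/subsetP => _ /imsetP[[S b] Pb ->].
  move: Pb; rewrite !inE /= => /andP[/andP[/andP[/eqP cS /eqP mS] /andP[bS xb]] bx].
  have xbb : x b != b by apply: contraNneq xb => ->.
  have := misses_remove bS xb; rewrite bx addn0 mS => ->.
  have := cardsD1 b S; rewrite bS cS add1n => [[<-]].
  rewrite !eqxx permKV eqxx /= andbT; apply/andP; split.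
    by apply: contraNneq xbb => E; rewrite -{1}E permKV.
  by case/imsetP: bx => s sS ->; rewrite permK.
set P := _ :\: _.
pose f (p : {set X} * X) := (p.1 :\ p.2, p.2).
have injf : {in P &, injective f}.
  move=> [S b] [S' b']; rewrite !inE /= => /andP[_ /andP[_ /andP[bS _]]].
  move=> /andP[_ /andP[_ /andP[bS' _]]] [E E'].
  by rewrite -(setD1K bS) -(setD1K bS') E E'.
rewrite mulnC -cardsT -cardsX -(card_in_imset injf).
apply/subset_leq_card/subsetP => _ /imsetP[[S b] Pb ->].
move: Pb; rewrite !inE /= => /andP[bx /andP[/andP[/eqP cS /eqP mS] /andP[bS xb]]].
have := misses_remove bS xb; rewrite bx addn1 mS => [[->]].
by have := cardsD1 b S; rewrite bS cS add1n => [[<-]]; rewrite !eqxx.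
Qed.

Lemma card_small_subsets (T : finType) (A : {set T}) d :
  #|[set P : {set T} | (P \subset A) && (#|P| <= d)]| <= 'C(#|A| + d, d).
Proof.
have -> : #|[set P : {set T} | (P \subset A) && (#|P| <= d)]| = \sum_(j < d.+1) 'C(#|A|, j).
  rewrite -sum1_card (partition_big (fun P : {set T} => inord #|P| : 'I_d.+1) predT) //=.
  apply: eq_bigr => j _; rewrite -cards_draws -sum1_card; apply: eq_bigl => P.
  rewrite !inE -andbA; case: (P \subset A) => //=.
  apply/andP/eqP => [[le_d /eqP <-]|Pj]; first by rewrite inordK.
  by rewrite Pj -ltnS ltn_ord -Pj; split=> //; apply/eqP/val_inj; rewrite /= inordK // Pj.
rewrite -(binomial.Vandermonde #|A| d); apply: leq_sum => j _.
by rewrite leq_pmulr // bin_gt0 leq_subr.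
Qed.

(** A stable set is a union of cycles, and it consists of at most d of them. *)
Lemma num_misses0 x d : num_misses x d 0 <= 'C(#|porbits x| + d, d).
Proof.
apply: leq_trans (card_small_subsets (porbits x) d).
pose f S := [set porbit x s | s in S].
have closed S u v : misses S x == 0 -> u \in S -> v \in porbit x u -> v \in S.
  rewrite cards_eq0 => /eqP m0 uS /porbitP[j ->]; elim: j => [|j IHj].
    by rewrite expg0 perm1.
  rewrite expgSr permM; apply: contraFT (in_set0 ((x ^+ j)%g u)) => h.
  by rewrite -m0 inE IHj.
have fS S : misses S x == 0 -> cover (f S) = S.
  move=> m0; apply/setP => v; apply/bigcupP/idP => [[_ /imsetP[u uS ->]]|vS].
    exact: closed.
  by exists (porbit x v); rewrite ?porbit_id //; apply/imsetP; exists v.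
have injf : {in [set S : {set X} | (#|S| == d) && (misses S x == 0)] &, injective f}.
  move=> S S'; rewrite !inE => /andP[_ m0] /andP[_ m0'] E.
  by rewrite -(fS S) // -(fS S') // E.
rewrite /num_misses -(card_in_imset injf).
apply/subset_leq_card/subsetP => P /imsetP[S]; rewrite inE => /andP[/eqP cS _] ->.
rewrite inE -cS leq_imset_card andbT.
by apply/subsetP => _ /imsetP[s _ ->]; apply/imsetP; exists s.
Qed.


(** Pascal's rule solves the recursion [num_misses_rec]. *)
Lemma num_misses_bound x k d j : #|porbits x| <= k ->
  j`! * num_misses x d j <= 'C(d, j) * #|X| ^ j * 'C(k + d, d).
Proof.
move=> le_k.
have binE e : 'C(k + e, e) = 'C(k + e, k).
  by have := bin_sub (leq_addl k e); rewrite addnK.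
elim: d j => [|d IHd] [|j].
- rewrite mul1n bin0 mul1n expn0 mul1n.
  by apply: leq_trans (num_misses0 _ _) _; rewrite !bin0.
- have -> : num_misses x 0 j.+1 = 0; last by rewrite muln0.
  apply/eqP; rewrite cards_eq0; apply/eqP/setP => S; rewrite !inE cards_eq0.
  apply/negbTE/negP => /andP[/eqP-> /eqP].
  by rewrite /misses eq_card0 // => s; rewrite !inE.
- rewrite mul1n bin0 mul1n expn0 mul1n; apply: leq_trans (num_misses0 _ _) _.
  by apply: leq_bin2l; rewrite leq_add2r.
have mono : 'C(k + d, d) <= 'C(k + d.+1, d.+1).
  by rewrite !binE leq_bin2l // addnS.
apply: (@leq_trans (j.+1`! * num_misses x d j.+1 + #|X| * (j`! * num_misses x d j))).
  have := leq_mul (leqnn j`!) (num_misses_rec x d j); rewrite factS.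
  by move: (num_misses _ _ _) (num_misses _ _ _) (num_misses _ _ _) => p q r; nia.
apply: leq_trans (leq_add (IHd j.+1) (leq_mul (leqnn _) (IHd j))) _.
rewrite binS expnS !mulnA [#|X| * 'C(d, j)]mulnC -!mulnA !(mulnA #|X|) -expnS -mulnDl.
by rewrite leq_mul2l leq_mul2l mono !orbT.
Qed.

End CountMisses.

(** * Values of characters of a given level *)

Section CharacterBound.

Variable X : finType.
Local Notation Alt := 'Alt_X%G.
Implicit Types (S T : {set X}) (x y z g : {perm X}) (d j k : nat) (i : Iirr Alt).

(** The alternating group is (n - 2)-transitive. *)
Lemma Alt_transitive_sets S S' : #|S| = #|S'| -> (#|S| + 2 <= #|X|)%N ->
  exists2 g, g \in Alt & g @: S = S'.
Proof.
move=> eqS leS.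
have tr : [transitive^ #|S| Alt, on [set: X] | 'P].
  by apply: ntransitive_weak (Alt_trans X); move: leS; clear; lia.
have dt (U : {set X}) (cU : size (enum U) == #|S|) : Tuple cU \in (#|S|).-dtuple([set: X]).
  by rewrite inE /= enum_uniq; apply/subsetP => u; rewrite inE.
have c1 : size (enum S) == #|S| by rewrite -cardE.
have c2 : size (enum S') == #|S| by rewrite -cardE eqS.
have [g Gg E] := atransP2 tr (dt S c1) (dt S' c2).
have E' : enum S' = map g (enum S) by have /(congr1 val) := E.
exists g => //; apply/setP => v; rewrite -(mem_enum (mem S')) E'.
apply/imsetP/mapP => [[u uS ->]|[u uS ->]]; exists u => //; first by rewrite mem_enum.
by rewrite mem_enum in uS.
Qed.

Lemma sum_translates (F : {set X} -> algC) S : (#|S| + 2 <= #|X|)%N ->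
  'C(#|X|, #|S|)%:R * (\sum_(g in Alt) F (g @: S)) =
    #|Alt|%:R * \sum_(S' : {set X} | #|S'| == #|S|) F S'.
Proof.
move=> leS; rewrite -(card_draws X #|S|) mulr_natl -sumr_const.
transitivity (\sum_(S' : {set X} | #|S'| == #|S|) \sum_(g in Alt) F (g @: S')).
  apply: eq_big => [S'|S']; first by rewrite inE.
  rewrite inE => /eqP cS'; have [h Gh <-] := Alt_transitive_sets (esym cS') leS.
  rewrite (reindex_inj (mulgI h)) /=; apply: eq_big => [g|g _].
    by rewrite groupMl.
  by congr F; rewrite -imset_comp; apply: eq_imset => u /=; rewrite permM.
rewrite exchange_big mulr_natl -sumr_const; apply: eq_bigr => g Gg.
rewrite [RHS](reindex_inj (imset_inj (@perm_inj _ g))) /=.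
by apply: eq_bigl => S'; rewrite card_imset //; exact: perm_inj.
Qed.

Lemma misses_conj S x g : misses S (x ^ g)%g = misses (g^-1 @: S)%g x.
Proof.
rewrite /misses -[LHS](card_imset _ (@perm_inj _ g^-1%g)); apply: eq_card => v.
apply/imsetP/idP => [[s]|].
  rewrite !inE => /andP[sS xs] ->; rewrite imset_f //=.
  apply: contra xs => /imsetP[u uS E]; rewrite conjgE !permM E permKV //.
rewrite inE => /andP[/imsetP[s sS ->] xs]; exists s => //; rewrite inE sS /=.
apply: contra xs => h; apply/imsetP; exists ((x ^ g)%g s) => //.
by rewrite conjgE !permM permK.
Qed.

(** Since 4 d <= n, each factor of (n - d) ^_ j is at least n / 2, so the sets with
j leaving points contribute at most 'C(d, j) * 2 ^ j times the common binomial
coefficient, and these weights add up to 3 ^ d. *)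
Lemma sum_misses_inv x k d : (#|porbits x| <= k)%N -> (4 * d <= #|X|)%N ->
  \sum_(S : {set X} | #|S| == d) ('C(#|X| - d, misses S x)%:R)^-1
    <= (3 ^ d * 'C(k + d, d))%:R :> algC.
Proof.
move=> le_k le_d.
have le_misses S : #|S| == d -> (misses S x < d.+1)%N.
  move=> /eqP<-; rewrite ltnS; apply/subset_leq_card/subsetP => s.
  by rewrite inE => /andP[].
pose P := 'C(k + d, d).
have step j : (j <= d)%N ->
    (num_misses x d j)%:R * ('C(#|X| - d, j)%:R)^-1 <= ('C(d, j) * 2 ^ j * P)%:R :> algC.
  move=> jd; have bin_pos : (0 < 'C(#|X| - d, j))%N by rewrite bin_gt0; lia.
  rewrite ler_pdivrMr ?ltr0n // -natrM ler_nat -(leq_pmul2l (fact_gt0 j)).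
  apply: leq_trans (num_misses_bound d j le_k) _.
  have ff e : (e <= j)%N -> (#|X| ^ e <= 2 ^ e * (#|X| - d) ^_ e)%N.
    elim: e => // e IHe ej; rewrite !expnS ffactnSr.
    have [h1 h2] : (#|X| <= 2 * (#|X| - d - e))%N /\ (e <= j)%N by split; lia.
    have := leq_mul h1 (IHe h2); rewrite -!mulnA => h; apply: leq_trans h _.
    by rewrite leq_mul2l /= mulnCA leq_mul2l mulnC leqnn orbT.
  have := ff j (leqnn j); rewrite -bin_ffact => h.
  by have := leq_mul (leqnn ('C(d, j) * P)) h; rewrite -/P; move: P; clear; nia.
rewrite (partition_big (fun S => inord (misses S x) : 'I_d.+1) predT) //=.
apply: (@le_trans _ _ (\sum_(j < d.+1) ('C(d, j) * 2 ^ j * P)%:R)).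
  apply: ler_sum => j _; apply: le_trans (step j _); last by rewrite -ltnS.
  rewrite mulr_natl /num_misses -sumr_const; rewrite le_eqVlt; apply/orP; left; apply/eqP.
  rewrite (eq_bigl (fun S => S \in [set S : {set X} | (#|S| == d) && (misses S x == j)])).
    by apply: eq_bigr => S; rewrite inE => /andP[_ /eqP->].
  move=> S; rewrite inE; case: (boolP (#|S| == d)) => //= Sd.
  by rewrite -val_eqE /= inordK // le_misses.
rewrite -natr_sum ler_nat -big_distrl /= leq_mul2r orbC.
rewrite -[3%N]/(1 + 2)%N expnDn leq_sum // => j _.
by rewrite exp1n mul1n.
Qed.

Lemma bin_ratio n k d : (k <= n)%N -> (d <= k)%N -> (n ^ d * 'C(k, d) <= k ^ d * 'C(n, d))%N.
Proof.
move=> kn dk; rewrite -(leq_pmul2r (fact_gt0 d)) -!mulnA !bin_ffact.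
elim: d dk => // d IHd dk; rewrite !ffactnSr !expnS.
(* Compare the falling factorials factor by factor. *)
have h : (n * (k - d) <= k * (n - d))%N by rewrite !mulnBr; nia.
have := leq_mul (IHd (ltnW dk)) h.
by move: (n - d)%N (k - d)%N; clear; nia.
Qed.

(** Only sets of size d - 1 are excluded in the second part, since invariants under
the group of a smaller S are invariant under that of any larger one. *)
Definition has_level d i :=
  [exists S : {set X}, (#|S| == d) && (triv_mult (AltOn (~: S)) 'chi_i != 0)] &&
  [forall T : {set X}, (#|T| == (#|X| - d).+1) ==> (triv_mult (AltOn T) 'chi_i == 0)].

(** Averaged over the conjugates of x, the matrix coefficient becomes the
normalized character times the dimension of the invariants, because class sums act
as scalars.  The bound on the coefficient depends only on how many points of a
translate of S are moved out of it by x, and the translates of S are uniformly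
distributed among the sets of size d. *)
Lemma level_char_bound i x k d : x \in Alt -> has_level d i ->
  (#|porbits x| <= k)%N -> (4 * d + 4 <= #|X|)%N ->
  `|'chi_i x| * #|X|%:R ^+ d <= 'chi_i 1%g * (3 * (k + d))%:R ^+ d.
Proof.
move=> Gx /andP[/existsP[S /andP[/eqP cS mS]] /forallP level] le_k le_d.
have [lt_n|le_n] := ltnP #|X| (k + d).
  apply: ler_pM; rewrite ?exprn_ge0 ?ler0n //; first exact/char1_ge_norm/irr_char.
  rewrite lerXn2r ?qualifE /= ?ler0n // ler_nat.
  by apply: ltnW (leq_trans lt_n _); rewrite leq_pmull.
have le_S : (2 * #|S| + 2 <= #|X|)%N by rewrite cS; move: le_d; clear; lia.
have lev T : #|T| = (#|X| - #|S|).+1 -> triv_mult (AltOn T) 'chi_i = 0.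
  by move=> cT; apply/eqP; have := level T; rewrite cT cS eqxx.
have m_gt0 : 0 < triv_mult (AltOn (~: S)) 'chi_i.
  by rewrite lt0r mS natr_ge0 // triv_mult_nat // AltOn_sub.
set m := triv_mult _ _ in m_gt0.
have G_gt0 : 0 < #|Alt|%:R :> algC by rewrite ltr0n cardG_gt0.
have chi1_gt0 : 0 < 'chi_i 1%g by exact: irr1_gt0.
have sum_coef : \sum_(g in Alt) matrix_coef S i (x ^ g)%g = #|Alt|%:R * 'chi_i x * m / 'chi_i 1%g.
  rewrite -mulr_sumr exchange_big /= /m /triv_mult.
  rewrite (eq_bigr (fun a => #|Alt|%:R * 'chi_i x / 'chi_i 1%g * 'chi_i a)) => [|a Ka].
    rewrite -mulr_sumr; set u := _%:R^-1; set v := \sum_(_ in _) _.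
    by rewrite mulrCA -!mulrA; do 2!congr (_ * _); rewrite mulrC -mulrA.
  have Ga := subsetP (AltOn_sub _) _ Ka.
  rewrite mulrAC -sum_irr_conj // [RHS](reindex_inj invg_inj) /=.
  apply: eq_big => [g|g Gg]; first by rewrite groupV.
  by rewrite -(cfunJ 'chi_i (x * a ^ g^-1)%g Gg) conjMg conjgKV.
have le_coef g : g \in Alt ->
    `|matrix_coef S i (x ^ g)%g| <= m * ('C(#|X| - d, misses (g^-1 @: S)%g x)%:R)^-1.
  move=> Gg; have bin_gt0' : 0 < 'C(#|X| - d, misses (g^-1 @: S)%g x)%:R :> algC.
    rewrite ltr0n bin_gt0; apply: (@leq_trans d); last by move: le_d; clear; lia.
    rewrite -cS -(card_imset S (@perm_inj _ g^-1%g)).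
    by apply/subset_leq_card/subsetP => s; rewrite inE => /andP[].
  rewrite ler_pdivlMr // -misses_conj -cS.
  by apply: matrix_coef_bound => //; rewrite groupJ.
have leS2 : (#|S| + 2 <= #|X|)%N by move: le_S; clear; lia.
pose F S' : algC := ('C(#|X| - d, misses S' x)%:R)^-1.
have sumF : 'C(#|X|, d)%:R * \sum_(g in Alt) F (g @: S) <=
    #|Alt|%:R * (3 ^ d * 'C(k + d, d))%:R.
  rewrite -[in X in X * _]cS sum_translates // ler_pM2l // cS.
  by apply: sum_misses_inv => //; move: le_d; clear; lia.
have main : `|'chi_i x| * 'C(#|X|, d)%:R <= 'chi_i 1%g * (3 ^ d * 'C(k + d, d))%:R.
  have step : #|Alt|%:R * `|'chi_i x| * m <= 'chi_i 1%g * (m * \sum_(g in Alt) F (g @: S)).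
    rewrite -ler_pdivrMl // mulrC.
    have -> : #|Alt|%:R * `|'chi_i x| * m / 'chi_i 1%g =
        `|\sum_(g in Alt) matrix_coef S i (x ^ g)%g|.
      have E (N : nat) (a b c : algC) : 0 < b -> 0 < c -> N%:R * `|a| * b / c = `|N%:R * a * b / c|.
        by move=> b0 c0; rewrite !normrM normfV (gtr0_norm b0) (gtr0_norm c0) normr_nat.
      by rewrite sum_coef; apply: E.
    apply: le_trans (ler_norm_sum _ _ _) _.
    rewrite mulr_sumr [leRHS](reindex_inj invg_inj) /=.
    rewrite [leRHS](eq_bigl (mem Alt)) => [|g]; last first.
      by rewrite groupV.
    by apply: ler_sum => g Gg; apply: le_coef.
  have Gm_gt0 : 0 < #|Alt|%:R * m by rewrite mulr_gt0.
  rewrite -(ler_pM2l Gm_gt0).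
  have -> (a b : algC) : #|Alt|%:R * m * (a * b) = #|Alt|%:R * a * m * b by ring.
  apply: le_trans (ler_wpM2r (ler0n _ _) step) _; set Sg := \sum_(g in Alt) _ in sumF *.
  have -> (b c : algC) : c * (m * Sg) * b = c * m * (b * Sg) by ring.
  have cm_ge0 : 0 <= 'chi_i 1%g * m by rewrite mulr_ge0 // ltW.
  apply: le_trans (ler_wpM2l cm_ge0 sumF) _.
  by rewrite le_eqVlt; apply/orP; left; apply/eqP; ring.
have B_gt0 : 0 < 'C(#|X|, d)%:R :> algC.
  by rewrite ltr0n bin_gt0; move: le_d; clear; lia.
have := bin_ratio le_n (leq_addl k d); rewrite -(ler_nat algC) !natrM !natrX => ratio.
rewrite -(ler_pM2r B_gt0).
have -> (a b c : algC) : a * b * c = a * c * b by ring.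
apply: le_trans (ler_wpM2r _ main) _; first by rewrite exprn_ge0 ?ler0n.
rewrite exprMn !natrM natrX -!mulrA ler_pM2l // ler_pM2l ?exprn_gt0 ?ltr0n //.
by rewrite mulrC.
Qed.

End CharacterBound.

(** * Degrees by level, and permutations with many cycles *)

Section Levels.

Variable X : finType.
Local Notation Alt := 'Alt_X%G.
Implicit Types (S T : {set X}) (x y z g : {perm X}) (d j k m : nat) (i : Iirr Alt).

Lemma AltOnJ T x g : g \in Alt -> ((x ^ g)%g \in AltOn (g @: T)) = (x \in AltOn T).
Proof.
move=> Gg; apply/AltOnP/AltOnP => -[ev fx]; split.
- by move: ev; rewrite odd_permJ.
- move=> u uT; have := fx (g u); rewrite mem_imset; last exact: perm_inj.
  by move=> /(_ uT); rewrite conjgE !permM permK => /perm_inj.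
- by rewrite odd_permJ.
move=> u uT; rewrite conjgE !permM fx ?permKV //.
by apply: contra uT => h; apply/imsetP; exists (g^-1%g u); rewrite // permKV.
Qed.

Lemma triv_multJ T g i : g \in Alt ->
  triv_mult (AltOn (g @: T)) 'chi_i = triv_mult (AltOn T) 'chi_i.
Proof.
move=> Gg; have E : (AltOn (g @: T) = AltOn T :^ g :> {set _})%g.
  by apply/setP => x; rewrite mem_conjg -(AltOnJ T _ Gg) conjgKV.
rewrite /triv_mult E cardJg; congr (_ * _).
rewrite (reindex_inj (conjg_inj g)) /=; apply: eq_big => [x|x _].
  by rewrite memJ_conjg.
by rewrite cfunJ.
Qed.

Lemma triv_mult_card S S' i : #|S| = #|S'| -> (#|S| + 2 <= #|X|)%N ->
  triv_mult (AltOn (~: S)) 'chi_i = triv_mult (AltOn (~: S')) 'chi_i.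
Proof.
move=> eqS leS; have [g Gg <-] := Alt_transitive_sets eqS leS.
rewrite -(triv_multJ (~: S) _ Gg); congr (triv_mult (AltOn _) _).
apply/setP => u; rewrite inE -(permKV g u) !(mem_imset _ _ (@perm_inj _ g)).
by rewrite inE.
Qed.

(** Two permutations with the same restriction to S are in the same coset. *)
Lemma card_Alt_le S : (#|Alt| <= #|AltOn (~: S)| * #|X| ^ #|S|)%N.
Proof.
pose R := {ffun {s | s \in S} -> X}.
pose f (g : {perm X}) : R := [ffun s => g (val s)].
have -> : (#|X| ^ #|S|)%N = #|R| by rewrite card_ffun card_sig.
rewrite mulnC -sum1_card (partition_big f predT) //= -sum_nat_const.
apply: leq_sum => r _.
have [/existsP[h /andP[Gh /eqP fh]]|/existsPn none] :=
    boolP [exists h, (h \in Alt) && (f h == r)]; last first.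
  by rewrite big1 // => g Ag; have := none g; rewrite Ag.
rewrite -(card_rcoset _ h) sum1_card; apply/subset_leq_card/subsetP => g.
rewrite unfold_in mem_rcoset => /andP[Gg /eqP fg]; apply/AltOnP.
have : (g * h^-1)%g \in Alt by rewrite groupM ?groupV.
rewrite Alt_even => ev; split=> // s; rewrite inE negbK => sS.
rewrite permM; apply: (@perm_inj _ h); rewrite permKV.
have /ffunP/(_ (exist _ s sS)) : f g = f h by rewrite fg fh.
by rewrite !ffunE.
Qed.

(** The left-hand side is the mean over AltOn (~: S) of the regular character,
which is the index of this subgroup. *)
Lemma sum_degree_triv_mult S :
  \sum_i 'chi[Alt]_i 1%g * triv_mult (AltOn (~: S)) 'chi_i <= #|X|%:R ^+ #|S|.
Proof.
set K := AltOn _.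
have K_gt0 : 0 < #|K|%:R :> algC by rewrite ltr0n cardG_gt0.
have -> : \sum_i 'chi[Alt]_i 1%g * triv_mult K 'chi_i =
    #|K|%:R^-1 * \sum_(x in K) cfReg Alt x.
  rewrite (eq_bigr (fun x => \sum_i 'chi[Alt]_i 1%g * 'chi_i x) (F1 := cfReg Alt))
    => [|x _]; last first.
    by rewrite cfReg_sum sum_cfunE; apply: eq_bigr => i _; rewrite cfunE.
  rewrite exchange_big mulr_sumr; apply: eq_bigr => i _.
  by rewrite -mulr_sumr mulrCA.
rewrite (bigD1 1%g) //= big1 => [|x /andP[_ /negPf x1]]; last by rewrite cfRegE x1.
rewrite addr0 cfRegE eqxx mulrC ler_pdivrMr // -natrX -natrM ler_nat mulnC.
exact: card_Alt_le.
Qed.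

(** A character of level d has multiplicity at least 1 in [sum_degree_triv_mult],
so that the degrees, and not only their squares, add up to at most n ^ d. *)
Lemma sum_degree_sq_level d : (d + 2 <= #|X|)%N ->
  \sum_(i | has_level d i) 'chi[Alt]_i 1%g ^+ 2 <= #|X|%:R ^+ (2 * d).
Proof.
move=> le_d.
have [S cS] : exists S : {set X}, #|S| = d.
  exists [set u in take d (enum X)]; rewrite cardsE (card_uniqP (take_uniq _ (enum_uniq _))).
  by rewrite size_takel // -cardT; move: le_d; clear; lia.
have chi0 i : 0 <= 'chi[Alt]_i 1%g by rewrite ltW ?irr1_gt0.
have mult0 i : 0 <= triv_mult (AltOn (~: S)) 'chi_i.
  by rewrite natr_ge0 // triv_mult_nat // AltOn_sub.
have le1 : \sum_(i | has_level d i) 'chi[Alt]_i 1%g <= #|X|%:R ^+ d.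
  rewrite -cS; apply: le_trans (sum_degree_triv_mult S).
  rewrite [leRHS](bigID (has_level d)) /= -[leLHS]addr0 lerD //; last first.
    by apply: sumr_ge0 => i _; rewrite mulr_ge0.
  rewrite cS; apply: ler_sum => i /andP[/existsP[S' /andP[/eqP cS' mS']] _].
  rewrite ler_peMr //.
  have /natrP[[|k] E] : triv_mult (AltOn (~: S)) 'chi_i \in Num.nat.
    by rewrite triv_mult_nat // AltOn_sub.
  - case/eqP: mS'; rewrite (triv_mult_card (S' := S)) ?cS' ?cS //.
  by rewrite E ler1n.
have le_each i : has_level d i -> 'chi[Alt]_i 1%g <= #|X|%:R ^+ d.
  move=> lev; apply: le_trans le1; rewrite (bigD1 i) //= lerDl.
  by apply: sumr_ge0 => j _.
apply: (@le_trans _ _ (\sum_(i | has_level d i) #|X|%:R ^+ d * 'chi[Alt]_i 1%g)).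
  by apply: ler_sum => i lev; rewrite expr2 ler_wpM2r // le_each.
by rewrite -mulr_sumr mul2n -addnn exprD ler_wpM2l // exprn_ge0 ?ler0n.
Qed.

(** If the degree is small, invariants exist for some set of size 3 * m, and the
level is the least size for which they exist. *)
Lemma level_or_large m i : i != 0 -> (3 * m + 2 <= #|X|)%N ->
  (exists2 d, (0 < d <= 3 * m)%N & has_level d i) \/ 2 ^+ m <= 'chi_i 1%g.
Proof.
move=> nz_i le_m.
have real1 : 'chi_i 1%g \is Num.real by rewrite ger0_real // ltW ?irr1_gt0.
have real2 : 2 ^+ m \is @Num.real algC by rewrite ger0_real // exprn_ge0 ?ler0n.
(* The order on algC is partial, whence the detour through Num.real. *)
have [|lt] := real_leP real2 real1; first by right.
left.
have [T' [_ cT' mT']] : exists T', [/\ T' \subset setT, #|T'| = (#|[set: X]| - 3 * m)%N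
               & triv_mult (AltOn T') 'chi_i != 0].
  by apply: small_degree_invariants => //; rewrite ?cardsT ?AltOnT.
rewrite cardsT in cT'.
pose p d := [exists S : {set X}, (#|S| == d) && (triv_mult (AltOn (~: S)) 'chi_i != 0)].
have p3m : p (3 * m)%N.
  apply/existsP; exists (~: T'); rewrite setCK mT' andbT cardsCs setCK cT'.
  by apply/eqP; move: le_m; clear; lia.
have exp : exists d, p d by exists (3 * m)%N.
case: (ex_minnP exp) => d pd min_d.
have d_gt0 : (0 < d)%N.
  rewrite lt0n; apply: contraNneq nz_i => d0; move: pd; rewrite d0.
  case/existsP => S /andP[]; rewrite cards_eq0 => /eqP->.
  rewrite setC0; apply: contraR => i0; apply/eqP.
  rewrite /triv_mult AltOnT -[LHS]/(triv_mult Alt 'chi_i) triv_multE // cfRes_id.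
  by rewrite -(irr0 Alt) cfdot_irr (negPf i0).
exists d; first by rewrite d_gt0 min_d.
rewrite /has_level -/(p d) pd; apply/forallP => T; apply/implyP => /eqP cT.
have dm := min_d _ p3m; apply: contraT => mT; suff : (d <= d.-1)%N by move: d_gt0; clear; lia.
apply: min_d; apply/existsP; exists (~: T); rewrite setCK mT andbT.
rewrite cardsCs setCK cT.
by apply/eqP; move: dm d_gt0 le_m; clear; lia.
Qed.

End Levels.

Section CountCycles.

Local Open Scope nat_scope.

Variables n t : nat.

Definition recolor (c : {ffun 'I_n -> 'I_t}) (x : 'S_n) : {ffun 'I_n -> 'I_t} :=
  [ffun u => c (x^-1%g u)].

Fact recolor_is_action : is_action [set: 'S_n] recolor.
Proof.
apply: is_total_action => [c|c x y]; apply/ffunP => u; rewrite !ffunE.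
  by rewrite invg1 perm1.
by rewrite invMg permM.
Qed.
Canonical recolor_action := Action recolor_is_action.

(** A colouring that is constant on the cycles of x is fixed by x. *)
Lemma le_card_colorings (x : 'S_n) :
  t ^ #|porbits x| <= #|'Fix_([set: {ffun 'I_n -> 'I_t}] | recolor_action)[x]%g|.
Proof.
pose R := {ffun {P | P \in porbits x} -> 'I_t}.
have -> : t ^ #|porbits x| = #|R| by rewrite card_ffun card_sig card_ord.
have po u : porbit x u \in porbits x by apply/imsetP; exists u.
pose F (r : R) : {ffun 'I_n -> 'I_t} := [ffun u => r (exist _ (porbit x u) (po u))].
have injF : injective F.
  move=> r r' E; apply/ffunP => -[P PP]; have /imsetP[u _ Pu] := PP.
  have := congr1 (fun f : {ffun 'I_n -> 'I_t} => f u) E; rewrite !ffunE.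
  suff -> : exist _ P PP = exist _ (porbit x u) (po u) :> {P | P \in porbits x} by [].
  exact: val_inj.
rewrite -(card_imset _ injF); apply/subset_leq_card/subsetP => _ /imsetP[r _ ->].
apply/setIP; split; first by rewrite inE.
apply/afix1P/ffunP => u; rewrite !ffunE; congr (r _); apply: val_inj => /=.
by rewrite -(porbit_perm x 1 (x^-1%g u)) expg1 permKV.
Qed.

(** An orbit of colourings is determined by how often each colour is used. *)
Lemma card_color_orbits :
  #|[set orbit recolor_action [set: 'S_n] c | c in [set: {ffun 'I_n -> 'I_t}]]|
    <= n.+1 ^ t.
Proof.
pose counts (c : {ffun 'I_n -> 'I_t}) : {ffun 'I_t -> 'I_n.+1} :=
  [ffun k => inord (count_mem k [tuple c u | u < n])].
have same c c' : counts c = counts c' ->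
    orbit recolor_action [set: 'S_n] c = orbit recolor_action [set: 'S_n] c'.
  move=> E; have /tuple_permP[p Ep] : perm_eq [tuple c u | u < n] [tuple c' u | u < n].
    apply/allP => k _; have /ffunP/(_ k) := E; rewrite !ffunE => /(congr1 (@nat_of_ord _)).
    have bd (b : {ffun 'I_n -> 'I_t}) : count_mem k [tuple b u | u < n] < n.+1.
      by rewrite ltnS (leq_trans (count_size _ _)) // size_tuple.
    by rewrite !inordK ?bd // => E'; apply/eqP.
  apply/orbit_eqP; apply/imsetP; exists (p^-1)%g; rewrite ?inE //.
  apply/ffunP => u; rewrite ffunE invgK.
  have := congr1 (fun s => nth (c u) s u) Ep.
  rewrite -!tnth_nth !tnth_mktuple //.
pose h (r : {ffun 'I_t -> 'I_n.+1}) := if [pick c | counts c == r] is Some c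
  then orbit recolor_action [set: 'S_n] c else set0.
apply: (@leq_trans #|h @: [set: {ffun 'I_t -> 'I_n.+1}]|).
  apply/subset_leq_card/subsetP => _ /imsetP[c _ ->]; apply/imsetP; exists (counts c) => //.
  rewrite /h; case: pickP => [c' /eqP E|/(_ c)]; last by rewrite eqxx.
  exact: same.
by apply: leq_trans (leq_imset_card _ _) _; rewrite cardsT card_ffun !card_ord.
Qed.

(** Burnside's formula: the mean number of fixed colourings is the number of
orbits. *)
Lemma count_many_cycles k :
  #|[set x : 'S_n | k < #|porbits x|]| * t ^ k.+1 <= n`! * n.+1 ^ t.
Proof.
have [->|t_gt0] := posnP t; first by rewrite exp0n ?muln0.
have FC := @Frobenius_Cauchy _ _ _ recolor_action [set: 'S_n]%G [set: {ffun 'I_n -> 'I_t}].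
rewrite cardsT card_Sn in FC.
apply: (@leq_trans (\sum_(x in [set: 'S_n]) #|'Fix_([set: {ffun 'I_n -> 'I_t}] | recolor_action)[x]%g|)).
  rewrite (bigID (fun x : 'S_n => k < #|porbits x|)) /=; apply: leq_trans (leq_addr _ _).
  rewrite -sum_nat_const [leqRHS](eq_bigl [in [set x : 'S_n | k < #|porbits x|]]) => [|x].
    apply: leq_sum => x; rewrite inE => lt_k; apply: leq_trans (le_card_colorings x).
    by rewrite leq_pexp2l.
  by rewrite !inE.
rewrite FC; first by rewrite mulnC leq_mul2l card_color_orbits orbT.
by apply/actsP => x _ c; rewrite !inE.
Qed.
End CountCycles.

(** * The Fourier expansion of the distance to uniform *)

Section SquaredDistance.

Variables (gT : finGroupType) (G : {group gT}) (A : {set gT}).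

(** The walk is defined over any field because its law is rational: the distance
is computed over the algebraic numbers, where characters live, and transferred to
the reals through the rationals by [sq_dist_rmorph]. *)
Definition conv_over (F : fieldType) (f g : gT -> F) : gT -> F :=
  fun t => (\sum_(s in G) f s^-1%g * g (s * t)%g) / #|G|%:R.

Definition walk_density (F : fieldType) : gT -> F :=
  fun s => #|G|%:R / #|A|%:R * (s \in A)%:R.

Definition walk_power (F : fieldType) (l : nat) : gT -> F :=
  iter l.-1 (conv_over (walk_density F)) (walk_density F).

Definition sq_dist (F : fieldType) (l : nat) : F :=
  (\sum_(s in G) (walk_power F l s - 1) ^+ 2) / #|G|%:R.

Lemma sq_dist_rmorph (F : fieldType) (E : fieldType) (h : {rmorphism F -> E}) l :
  sq_dist E l = h (sq_dist F l).
Proof.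
have walk s : walk_power E l s = h (walk_power F l s).
  rewrite /walk_power; elim: l.-1 s => [|j IHj] s /=.
    by rewrite /walk_density rmorphM fmorph_div !rmorph_nat.
  rewrite /conv_over fmorph_div rmorph_nat rmorph_sum; congr (_ / _).
  apply: eq_bigr => u _; rewrite rmorphM -IHj; congr (_ * _).
  by rewrite /walk_density rmorphM fmorph_div !rmorph_nat.
rewrite /sq_dist fmorph_div rmorph_nat rmorph_sum; congr (_ / _).
by apply: eq_bigr => s _; rewrite rmorphXn rmorphB rmorph1 walk.
Qed.

Hypothesis nAG : A <| G.
Hypothesis A_neq0 : A != set0.

(** The Fourier coefficient of the part of the density carried by B; the factor
is normalized by A, so that a partition of A splits the coefficient. *)
Definition fourier (B : {set gT}) (i : Iirr G) : algC :=
  #|A|%:R^-1 * \sum_(x in B) ('chi_i x)^*.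

Let cG : #|G|%:R != 0 :> algC.
Proof. by rewrite pnatr_eq0 -lt0n cardG_gt0. Qed.
Let cA : #|A|%:R != 0 :> algC.
Proof. by rewrite pnatr_eq0 cards_eq0. Qed.

Lemma fourierE (B : {set gT}) i : B <| G ->
  fourier B i = '[(#|G|%:R / #|A|%:R) *: '1_B, 'chi_i].
Proof.
move=> nBG; have sBG := normal_sub nBG.
rewrite cfdotZl cfdotE /fourier; set U := \sum_(x in G) _.
have -> : #|G|%:R / #|A|%:R * (#|G|%:R^-1 * U) = #|A|%:R^-1 * U by field; rewrite cG cA.
congr (_ * _); rewrite /U {U}.
rewrite [RHS](bigID (mem B)) /= [X in _ + X]big1 => [|x /andP[_ /negPf xB]].
  rewrite addr0; apply: eq_big => [x|x xB]; last by rewrite cfuniE // xB mul1r.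
  by rewrite andb_idl // => /(subsetP sBG).
by rewrite cfuniE // xB mul0r.
Qed.

Lemma sum_fourier_sq (B : {set gT}) : B <| G ->
  \sum_i `|fourier B i| ^+ 2 = #|G|%:R * #|B|%:R / #|A|%:R ^+ 2.
Proof.
move=> nBG; have sBG := normal_sub nBG.
pose phi : 'CF(G) := (#|G|%:R / #|A|%:R) *: '1_B.
transitivity ('[phi, phi]).
  by rewrite [RHS]cfdot_sum_irr; apply: eq_bigr => i _; rewrite normCK fourierE.
rewrite /phi cfdotZl cfdotZr cfdotE.
rewrite [X in _^-1 * X](_ : _ = #|B|%:R); last first.
  rewrite -sumr_const [LHS](bigID (mem B)) /= [X in _ + X]big1 => [|x /andP[_ /negPf xB]].
    rewrite addr0; apply: eq_big => [x|x /andP[_ xB]].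
      by rewrite andb_idl // => /(subsetP sBG).
    by rewrite cfuniE // xB rmorph_nat -natrM.
  by rewrite cfuniE // xB mul0r.
rewrite rmorphM fmorphV !rmorph_nat; field.
by rewrite cG cA.
Qed.

(** Characters are orthogonal idempotents for convolution, up to the factor
1 / 'chi_i 1. *)
Lemma walk_powerE l t : t \in G -> (0 < l)%N ->
  walk_power algC l t =
    \sum_i fourier A i ^+ l / 'chi[G]_i 1%g ^+ l.-1 * 'chi_i t.
Proof.
case: l => // l Gt _; rewrite /walk_power /=.
have base t' : walk_density algC t' = \sum_i fourier A i * 'chi[G]_i t'.
  have -> : walk_density algC t' = ((#|G|%:R / #|A|%:R) *: ('1_A : 'CF(G))) t'.
    by rewrite cfunE cfuniE.
  rewrite {1}[_ *: _]cfun_sum_cfdot sum_cfunE; apply: eq_bigr => i _.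
  by rewrite cfunE fourierE.
elim: l t Gt => [|l IHl] t Gt /=.
  by rewrite base; apply: eq_bigr => i _; rewrite expr0 divr1.
rewrite /conv_over (eq_bigr (fun s => \sum_i \sum_j fourier A i *
    (fourier A j ^+ l.+1 / 'chi_j 1%g ^+ l) * ('chi[G]_j (s * t)%g * 'chi_i s^-1%g))); last first.
  move=> s Gs; rewrite IHl ?groupM // base mulr_suml; apply: eq_bigr => i _.
  by rewrite mulr_sumr; apply: eq_bigr => j _; rewrite mulrACA [_ * 'chi_j _]mulrC.
have inner (u : algC) i j :
    (\sum_(s in G) u * ('chi[G]_j (s * t)%g * 'chi_i s^-1%g)) / #|G|%:R =
      (j == i)%:R * (u * ('chi_j t / 'chi_j 1%g)).
  by rewrite -mulr_sumr -mulrA [X in _ * X]mulrC generalized_orthogonality_relation mulrCA.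
rewrite exchange_big mulr_suml; apply: eq_bigr => i _ /=.
rewrite exchange_big mulr_suml (eq_bigr _ (fun j _ => inner _ i j)) (bigD1 i) //=.
rewrite [X in _ + X]big1 => [|j /negPf ne_ji]; last by rewrite ne_ji mul0r.
rewrite addr0 eqxx mul1r !exprS; have := irr1_neq0 i.
move: (fourier A i) ('chi_i 1%g) ('chi_i t) => u v w nz_v.
by field; rewrite nz_v expf_neq0.
Qed.

Lemma sq_distE l : (0 < l)%N ->
  sq_dist algC l =
    \sum_(i : Iirr G | i != 0) `|fourier A i| ^+ (2 * l) / 'chi_i 1%g ^+ (2 * l.-1).
Proof.
move=> l_gt0.
pose c i := fourier A i ^+ l / 'chi[G]_i 1%g ^+ l.-1.
have c0 : c 0 = 1.
  rewrite /c irr0 cfun11 expr1n divr1 /fourier.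
  rewrite (eq_bigr (fun=> 1)) => [|x xA].
    by rewrite sumr_const mulVf // expr1n.
  by rewrite irr0 cfun1E (subsetP (normal_sub nAG)) // rmorph1.
pose phi : 'CF(G) := \sum_(i | i != 0) c i *: 'chi_i.
have phiE s : s \in G -> walk_power algC l s - 1 = phi s.
  move=> Gs; rewrite walk_powerE // (bigD1 0) //= -/(c 0) c0 mul1r irr0 cfun1E Gs.
  by rewrite addrAC subrr add0r sum_cfunE; apply: eq_bigr => i _; rewrite cfunE.
have walk_real s : walk_power algC l s \is Num.real.
  rewrite /walk_power; elim: l.-1 s => [|j IHj] s /=.
    by rewrite !realM ?realV ?realn.
  rewrite realM ?realV ?realn // sum_real // => u _.
  by rewrite realM // !realM ?realV ?realn.
transitivity '[phi, phi].
  rewrite /sq_dist cfdotE mulrC; congr (_ * _); apply: eq_bigr => s Gs.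
  by rewrite -normCK -phiE // real_normK // realB ?real1.
have coord j : '[phi, 'chi_j] = c j *+ (j != 0).
  rewrite cfdot_suml; have [->|nz_j] := eqVneq j 0.
    by rewrite big1 ?mulr0n // => i nz_i; rewrite cfdotZl cfdot_irr (negPf nz_i) mulr0.
  rewrite (bigD1 j) //= big1 => [|i /andP[_ /negPf ne]].
    by rewrite addr0 cfdotZl cfdot_irr eqxx mulr1.
  by rewrite cfdotZl cfdot_irr ne mulr0.
rewrite cfdot_sum_irr (bigD1 0) //= !coord mulr0n mul0r add0r.
apply: eq_bigr => i nz_i; rewrite coord nz_i mulr1n -normCK /c normrM normfV !normrX.
rewrite (ger0_norm (ltW (irr1_gt0 i))) expr_div_n -!exprM.
by rewrite [(l * 2)%N]mulnC [(l.-1 * 2)%N]mulnC.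
Qed.

End SquaredDistance.

(** * The distance in terms of cardinalities *)

Lemma add_pow_le (F : numDomainType) (u v : F) l : 0 <= u -> 0 <= v ->
  (u + v) ^+ (2 * l) <= 4 ^+ l * (u ^+ (2 * l) + v ^+ (2 * l)).
Proof.
move=> u0 v0.
have dbl (w : F) : (w *+ 2) ^+ (2 * l) = 4 ^+ l * w ^+ (2 * l).
  have -> : 4 = 2 ^+ 2 :> F by rewrite -natrX.
  have -> : w *+ 2 = 2 * w by rewrite mulr_natl.
  by rewrite exprMn -exprM.
have real (w : F) : 0 <= w -> w \is Num.real by exact: ger0_real.
have pow0 (w : F) : 0 <= w -> 0 <= w ^+ (2 * l) by move=> ?; rewrite exprn_ge0.
have c0 : 0 <= 4 ^+ l :> F by rewrite exprn_ge0 ?ler0n.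
have [uv|/ltW vu] := real_leP (real _ u0) (real _ v0).
  apply: (@le_trans _ _ ((v *+ 2) ^+ (2 * l))).
    by rewrite lerXn2r ?qualifE /= ?addr_ge0 ?mulrn_wge0 // mulr2n lerD2r.
  by rewrite dbl ler_wpM2l // lerDr pow0.
apply: (@le_trans _ _ ((u *+ 2) ^+ (2 * l))).
  by rewrite lerXn2r ?qualifE /= ?addr_ge0 ?mulrn_wge0 // mulr2n lerD2l.
by rewrite dbl ler_wpM2l // lerDl pow0.
Qed.

Lemma sum_pow_le (F : numDomainType) (I : finType) (u : I -> F) l :
  (forall i, 0 <= u i) -> (0 < l)%N ->
  \sum_i u i ^+ l <= (\sum_i u i) ^+ l.
Proof.
move=> u0; case: l => // l _; elim: l => [|l IHl]; first by rewrite expr1.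
rewrite exprS; apply: le_trans (ler_wpM2l (sumr_ge0 _ _) IHl) => //.
rewrite mulr_suml; apply: ler_sum => i _; rewrite exprS ler_wpM2l //.
rewrite (bigD1 i) //= lerDl; apply: sumr_ge0 => j _; exact: exprn_ge0.
Qed.

(** The bound of [sq_dist_le] for a group of order g, a normal subset of size a of
which b elements have more than k cycles.  The three terms account for the levels
up to k, for the remaining characters, and for the elements with many cycles.  In
the second one, the two summands bound (|a_chi| / chi(1)) ^+ 2 for levels between
k and 3 * m, and for levels above 3 * m.  It is a rational function over an arbitrary
field for the sake of the transfer from algebraic numbers to reals. *)
Definition dist_bound (F : fieldType) (n k l m g a b : nat) : F :=
  4 ^+ l * (\sum_(1 <= d < k.+1) n%:R ^+ (2 * d) * ((6 * k)%:R / n%:R) ^+ (2 * l * d)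
    + (((18 * m)%:R / n%:R) ^+ (2 * k) + g%:R / a%:R / 4 ^+ m) ^+ l.-1 * (g%:R / a%:R)
    + (g%:R * b%:R / a%:R ^+ 2) ^+ l).

Lemma dist_bound_rmorph (F E : fieldType) (h : {rmorphism F -> E}) n k l m g a b :
  dist_bound E n k l m g a b = h (dist_bound F n k l m g a b).
Proof.
rewrite /dist_bound; move: (6 * k)%N (18 * m)%N => p q.
rewrite rmorphM rmorphXn rmorph_nat !rmorphD rmorph_sum; congr (_ * (_ + _ + _)).
- by apply: eq_bigr => d _; rewrite rmorphM !rmorphXn fmorph_div !rmorph_nat.
- by rewrite rmorphM rmorphXn rmorphD rmorphXn !fmorph_div rmorphXn !rmorph_nat.
by rewrite rmorphXn fmorph_div rmorphM rmorphXn !rmorph_nat.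
Qed.

Section MainEstimate.

Variable X : finType.
Local Notation Alt := 'Alt_X%G.
Local Notation n := #|X|.
Variables (A : {set {perm X}}) (k l m : nat).
Hypotheses (nAG : A <| Alt) (A_neq0 : A != set0) (l_gt0 : (0 < l)%N).
Hypotheses (k_le : (k + 2 <= n)%N) (m_le : (18 * m <= n)%N) (m_le' : (12 * m + 4 <= n)%N).

Let bad := [set x in A | (k < #|porbits x|)%N].
Let good := [set x in A | (#|porbits x| <= k)%N].

Lemma card_porbitsJ (x g : {perm X}) : #|porbits (x ^ g)%g| = #|porbits x|.
Proof.
have po y : porbit (x ^ g)%g (g y) = g @: porbit x y.
  apply/setP => v; apply/porbitP/imsetP => [[j ->]|[u /porbitP[j ->] ->]].
    exists ((x ^+ j)%g y); first by apply/porbitP; exists j.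
    by rewrite -conjXg conjgE !permM permK.
  by exists j; rewrite -conjXg conjgE !permM permK.
have -> : porbits (x ^ g)%g = (fun P : {set X} => g @: P) @: porbits x.
  apply/setP => P; apply/imsetP/imsetP => [[v _ ->]|[_ /imsetP[y _ ->] ->]].
    exists (porbit x (g^-1%g v)); first by apply/imsetP; exists (g^-1%g v).
    by rewrite -po permKV.
  by exists (g y); rewrite ?po.
by rewrite card_imset //; exact/imset_inj/perm_inj.
Qed.

Lemma normal_cycle_part (P : pred nat) : [set x in A | P #|porbits x|] <| Alt.
Proof.
have /andP[sAG /subsetP nA] := nAG; apply/andP; split.
  by apply/subsetP => x; rewrite inE => /andP[/(subsetP sAG)].
apply/subsetP => g Gg; rewrite inE; apply/subsetP => _ /imsetP[x + ->].
by rewrite !inE card_porbitsJ memJ_norm ?nA.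
Qed.

Let a' (i : Iirr Alt) := fourier A good i.
Let a'' (i : Iirr Alt) := fourier A bad i.

Lemma fourier_split i : fourier A A i = a' i + a'' i :> algC.
Proof.
rewrite /a' /a'' /fourier -mulrDr; congr (_ * _).
rewrite (bigID (fun x : {perm X} => (#|porbits x| <= k)%N)) /=.
by congr (_ + _); apply: eq_bigl => x; rewrite inE // ltnNge.
Qed.

Let A_gt0 : 0 < #|A|%:R :> algC.
Proof. by rewrite ltr0n card_gt0. Qed.
Let n_gt0 : 0 < n%:R :> algC.
Proof. by rewrite ltr0n; move: m_le'; clear; lia. Qed.

Lemma good_fourier_level d i : (d <= 3 * m)%N -> has_level d i ->
  `|a' i| <= 'chi_i 1%g * ((3 * (k + d))%:R / n%:R) ^+ d.
Proof.
move=> le_d lev; rewrite /a' /fourier normrM normfV normr_nat mulrC ler_pdivrMr //.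
apply: le_trans (ler_norm_sum _ _ _) _.
set B := _ * _ ^+ d.
have B_ge0 : 0 <= B by rewrite mulr_ge0 ?exprn_ge0 ?divr_ge0 ?ler0n // ltW ?irr1_gt0.
apply: (@le_trans _ _ (\sum_(x in good) B)); last first.
  rewrite sumr_const -[leLHS]mulr_natr ler_wpM2l // ler_nat.
  by apply/subset_leq_card/subsetP => x; rewrite inE => /andP[].
apply: ler_sum => x; rewrite inE => /andP[xA le_k]; rewrite norm_conjC.
rewrite /B expr_div_n mulrA ler_pdivlMr ?exprn_gt0 //.
apply: level_char_bound => //; first exact: (subsetP (normal_sub nAG)).
by move: le_d m_le'; clear; lia.
Qed.

Let X0 : algC := ((18 * m)%:R / n%:R) ^+ (2 * k) + #|Alt|%:R / #|A|%:R / 4 ^+ m.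

(** At levels up to k the character bound is used for all factors.  At all other
levels two factors are kept for Parseval, and the character bound, or the degree
bound combined with Parseval, is used for the other 2 (l - 1). *)
Lemma good_term_le i : i != 0 ->
  `|a' i| ^+ (2 * l) / 'chi[Alt]_i 1%g ^+ (2 * l.-1) <=
    \sum_(1 <= d < k.+1) (has_level d i)%:R *
       ('chi_i 1%g ^+ 2 * ((6 * k)%:R / n%:R) ^+ (2 * l * d))
    + X0 ^+ l.-1 * `|a' i| ^+ 2.
Proof.
move=> nz_i; have chi_gt0 := irr1_gt0 i.
set c := 'chi_i 1%g in chi_gt0 *; set u := `|a' i|.
have u0 : 0 <= u by exact: normr_ge0.
have X0_ge0 : 0 <= X0.
  by rewrite addr_ge0 ?exprn_ge0 ?divr_ge0 ?ler0n // exprn_ge0 // ler0n.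
have S_ge0 : 0 <= \sum_(1 <= d < k.+1) (has_level d i)%:R *
       (c ^+ 2 * ((6 * k)%:R / n%:R) ^+ (2 * l * d)).
  apply: sumr_ge0 => d _; rewrite mulr_ge0 ?ler0n // mulr_ge0 ?exprn_ge0 ?divr_ge0 ?ler0n //.
  exact: ltW.
have R_ge0 : 0 <= X0 ^+ l.-1 * u ^+ 2 by rewrite mulr_ge0 ?exprn_ge0.
have tail : (u / c) ^+ 2 <= X0 -> u ^+ (2 * l) / c ^+ (2 * l.-1) <= X0 ^+ l.-1 * u ^+ 2.
  move=> le_X; have -> : u ^+ (2 * l) / c ^+ (2 * l.-1) = ((u / c) ^+ 2) ^+ l.-1 * u ^+ 2.
    case: (l) l_gt0 => // p _ /=.
    by rewrite mulnS exprD -exprM expr_div_n -mulrA mulrC.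
  by rewrite ler_wpM2r ?exprn_ge0 // lerXn2r ?qualifE //= exprn_ge0 // divr_ge0 // ltW.
have [| [d /andP[d_gt0 d_le] lev] | large] := level_or_large (m := m) nz_i.
- by move: m_le'; clear; lia.
- have le_u := good_fourier_level d_le lev; rewrite -/c -/u in le_u.
  have [le_dk|lt_kd] := leqP d k.
    rewrite -[leLHS]addr0 lerD // (bigD1_seq d) ?iota_uniq //=; last first.
      by rewrite mem_index_iota d_gt0 ltnS.
    rewrite lev mul1r -[leLHS]addr0 lerD //; last first.
      apply: sumr_ge0 => e _; rewrite mulr_ge0 ?ler0n // mulr_ge0 ?exprn_ge0 ?divr_ge0 ?ler0n //.
      exact: ltW.
    rewrite ler_pdivrMr ?exprn_gt0 //.
    have le_u2 : u <= c * ((6 * k)%:R / n%:R) ^+ d.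
      apply: le_trans le_u _; rewrite ler_wpM2l ?(ltW chi_gt0) //.
      rewrite lerXn2r ?qualifE /= ?divr_ge0 ?ler0n //.
      by rewrite ler_pM2r ?invr_gt0 // ler_nat; move: le_dk; clear; lia.
    apply: (@le_trans _ _ ((c * ((6 * k)%:R / n%:R) ^+ d) ^+ (2 * l))).
      by rewrite lerXn2r ?qualifE //= (le_trans u0 le_u2).
    rewrite exprMn -!exprM [(d * _)%N]mulnC -{1}(prednK l_gt0) mulnS exprD.
    by rewrite le_eqVlt; apply/orP; left; apply/eqP; ring.
  rewrite -[leLHS]add0r lerD // tail // -[leLHS]addr0 lerD //; last first.
    by rewrite !divr_ge0 ?ler0n // exprn_ge0 // ler0n.
  rewrite [(2 * k)%N]mulnC exprM lerXn2r ?qualifE /= ?divr_ge0 ?exprn_ge0 ?ler0n //.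
  - exact: ltW.
  - by rewrite divr_ge0 ?ler0n.
  rewrite ler_pdivrMr // mulrC; apply: le_trans le_u _; rewrite ler_wpM2l ?(ltW chi_gt0) //.
  apply: (@le_trans _ _ (((18 * m)%:R / n%:R) ^+ d)).
    rewrite lerXn2r ?qualifE /= ?divr_ge0 ?ler0n //.
    by rewrite ler_pM2r ?invr_gt0 // ler_nat; move: lt_kd d_le; clear; lia.
  rewrite ler_wiXn2l ?divr_ge0 ?ler0n ?(ltnW lt_kd) //.
  by rewrite ler_pdivrMr // mul1r ler_nat.
rewrite -[leLHS]add0r lerD // tail // -[leLHS]add0r lerD //.
  by rewrite exprn_ge0 ?divr_ge0 ?ler0n.
rewrite expr_div_n; apply: (@le_trans _ _ (u ^+ 2 / 4 ^+ m)).
  rewrite ler_wpM2l ?exprn_ge0 // lef_pV2 ?qualifE /= ?exprn_gt0 ?ltr0n //.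
  have -> : 4 = 2 ^+ 2 :> algC by rewrite -natrX.
  by rewrite exprAC lerXn2r ?qualifE /= ?exprn_ge0 ?ler0n // ltW.
rewrite ler_wpM2r ?invr_ge0 ?exprn_ge0 ?ler0n //.
apply: (@le_trans _ _ (\sum_j `|a' j| ^+ 2)).
  by rewrite [leRHS](bigD1 i) //= lerDl sumr_ge0 // => j _; rewrite exprn_ge0.
rewrite sum_fourier_sq //; last exact: (normal_cycle_part (fun j => (j <= k)%N)).
rewrite expr2 -mulf_div ler_piMr ?divr_ge0 ?ler0n // ler_pdivrMr // mul1r ler_nat.
by apply/subset_leq_card/subsetP => x; rewrite inE => /andP[].
Qed.

(** The coefficient is the sum of the contributions of the elements with few and
with many cycles.  The latter need no information on characters: by Parseval their
total is at most (g * b / a ^ 2) ^ l. *)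
Lemma sq_dist_le :
  sq_dist Alt A algC l <= dist_bound algC n k l m #|Alt| #|A| #|bad|.
Proof.
rewrite sq_distE //.
have chi_ge1 i : 1 <= 'chi[Alt]_i 1%g ^+ (2 * l.-1).
  have /natrP[p E] := Cnat_irr1 i; have := irr1_gt0 i.
  by rewrite E ltr0n => p_gt0; rewrite exprn_ege1 // ler1n.
apply: (@le_trans _ _ (4 ^+ l * (\sum_(i : Iirr Alt | i != 0)
    (`|a' i| ^+ (2 * l) / 'chi_i 1%g ^+ (2 * l.-1) + (`|a'' i| ^+ 2) ^+ l)))).
  rewrite mulr_sumr; apply: ler_sum => i nz_i.
  have c_gt0 : 0 < 'chi[Alt]_i 1%g ^+ (2 * l.-1) by rewrite exprn_gt0 ?irr1_gt0.
  rewrite ler_pdivrMr //; apply: le_trans (_ : (`|a' i| + `|a'' i|) ^+ (2 * l) <= _).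
    by rewrite lerXn2r ?qualifE /= ?addr_ge0 // fourier_split ler_normD.
  apply: le_trans (add_pow_le _ _ _) _ => //.
  rewrite -mulrA ler_wpM2l ?exprn_ge0 ?ler0n // mulrDl divfK ?gt_eqF // lerD2l.
  by rewrite -exprM ler_peMr ?exprn_ge0.
rewrite /dist_bound ler_wpM2l ?exprn_ge0 ?ler0n // big_split /= lerD //; last first.
  apply: (@le_trans _ _ (\sum_i (`|a'' i| ^+ 2) ^+ l)).
    rewrite [leRHS](bigID (fun i => i != 0)) /= lerDl; apply: sumr_ge0 => i _.
    by rewrite !exprn_ge0.
  apply: le_trans (sum_pow_le _ l_gt0) _; first by move=> i; rewrite exprn_ge0.
  by rewrite sum_fourier_sq //; exact: (normal_cycle_part (fun j => (k < j)%N)).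
apply: le_trans (ler_sum _ (fun i => good_term_le (i := i))) _.
rewrite big_split /= lerD //; last first.
  rewrite -mulr_sumr ler_wpM2l ?exprn_ge0 //.
    by rewrite addr_ge0 ?exprn_ge0 ?divr_ge0 ?ler0n // exprn_ge0 // ler0n.
  apply: (@le_trans _ _ (\sum_j `|a' j| ^+ 2)).
    rewrite [leRHS](bigID (fun i => i != 0)) /= lerDl; apply: sumr_ge0 => i _.
    by rewrite exprn_ge0.
  rewrite sum_fourier_sq //; last exact: (normal_cycle_part (fun j => (j <= k)%N)).
  rewrite expr2 -mulf_div ler_piMr ?divr_ge0 ?ler0n // ler_pdivrMr // mul1r ler_nat.
  by apply/subset_leq_card/subsetP => x; rewrite inE => /andP[].
rewrite exchange_big /= big_nat [leRHS]big_nat; apply: ler_sum => d /andP[d_gt0 d_le].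
have Y_ge0 : 0 <= ((6 * k)%:R / n%:R) ^+ (2 * l * d) :> algC.
  by rewrite exprn_ge0 ?divr_ge0 ?ler0n.
apply: (@le_trans _ _ (\sum_(i | has_level d i) 'chi[Alt]_i 1%g ^+ 2 *
    ((6 * k)%:R / n%:R) ^+ (2 * l * d))).
  rewrite [leRHS]big_mkcond [leLHS]big_mkcond /=; apply: ler_sum => i _.
  have := exprn_ge0 2 (ltW (irr1_gt0 i)); case: (has_level d i); rewrite ?mul1r ?mul0r.
    by move=> ?; case: eqP => // _; rewrite mulr_ge0.
  by case: eqP.
rewrite -mulr_suml ler_wpM2r // sum_degree_sq_level //.
by move: d_le k_le; clear; lia.
Qed.

End MainEstimate.

(** * Choice of the parameters *)

Section Asymptotics.

Variable R : realType.

Lemma expR1_lt3 : expR 1 < 3 :> R.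
Proof.
have h : expR (6^-1) <= 6 / 5 :> R.
  have := @expR_ge1Dx R (- 6^-1); rewrite expRN => h.
  have p := @expR_gt0 R (6^-1).
  rewrite -[leLHS]invrK -[leRHS]invrK lef_pV2 ?qualifE /= ?invr_gt0 //; lra.
have -> : 1 = 6%:R * 6^-1 :> R by lra.
rewrite expRM_natl; apply: (@le_lt_trans _ _ ((6 / 5) ^+ 6)); last by lra.
by rewrite lerXn2r ?qualifE /= ?expR_ge0 //; lra.
Qed.

Lemma expR1_ge2 : 2 <= expR 1 :> R.
Proof. have := @expR_ge1Dx R 1; lra. Qed.

Lemma geometric_sum_le (q : R) k : 0 <= q -> q <= 2^-1 ->
  \sum_(1 <= d < k.+1) q ^+ d <= 2 * q.
Proof.
move=> q0 q1; apply: (@le_trans _ _ (\sum_(1 <= d < k.+1) q ^+ d + 2 * q ^+ k.+1)).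
  by rewrite lerDl mulr_ge0 // exprn_ge0.
elim: k => [|k IHk]; first by rewrite big_geq // expr1 add0r.
rewrite big_nat_recr //= -addrA; apply: le_trans IHk; rewrite lerD2l.
rewrite [q ^+ k.+2]exprS; have := exprn_ge0 k.+1 q0; nra.
Qed.

(** Here L, w and N are ln n, n^(1/l) and n^(1-1/l), all written as exponentials so
that comparing bounds means comparing exponents.  The bound on l says that L <= w^c,
which makes every power of L that occurs harmless compared with w; and
N >= n^(1/2), since l >= 2. *)
Variables (L N w K c : R) (n l k m g a b : nat).
Hypotheses (l_gt1 : (1 < l)%N) (K_gt0 : 0 < K) (K_le : K <= 48^-1) (L_ge : 128 <= K ^+ 2 * L).
Hypotheses (nE : n%:R = expR L) (wE : w = expR (L / l%:R)) (NE : N = expR (L - L / l%:R)).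
Hypotheses (c_le : c <= K / 80) (l_le : l%:R * ln L < c * L).
Hypotheses (k_itv : k%:R <= K * N < k.+1%:R) (m_itv : N * L <= m%:R <= 2 * (N * L)).
Hypotheses (a_gt0 : (0 < a)%N) (g_gt0 : (0 < g)%N).
Hypothesis density_ge : g%:R / a%:R <= expR (c * N * L).
Hypothesis b_le : forall t : nat, (b * t ^ k.+1 <= 2 * g * n.+1 ^ t)%N.

Let KL_ge : 640 <= K * L.
Proof. have := K_gt0; have := K_le; have := L_ge; rewrite expr2; nra. Qed.
Let L_ge1 : 640 <= L.
Proof. have := K_gt0; have := K_le; have := KL_ge; nra. Qed.
Let L_gt0 : 0 < L. Proof. have := L_ge1; lra. Qed.
Let l_gt0 : 0 < l%:R :> R. Proof. by rewrite ltr0n ltnW. Qed.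
Let l_ge2 : 2 <= l%:R :> R. Proof. by rewrite ler_nat. Qed.

Let lnL_ge1 : 1 <= ln L.
Proof.
rewrite -ler_expR lnK ?posrE //; have := expR1_lt3; have := L_ge1; lra.
Qed.

Let l_le_cL : l%:R <= c * L.
Proof. have := l_le; have := lnL_ge1; have := l_gt0; nra. Qed.

(** The bound on l gives 4 l ln L <= L, hence L^2 <= w^(1/2). *)
Let L_le_sqrtw : 36 * L <= expR (L / l%:R / 2).
Proof.
apply: (@le_trans _ _ (L * L)); first by rewrite ler_pM2r //; have := L_ge1; lra.
rewrite -{1 2}[L]lnK ?posrE // -expRD ler_expR.
rewrite ler_pdivlMr // ler_pdivlMr //; have := l_le; have := c_le; have := K_le.
have := L_gt0; nra.
Qed.

Let Lw_le : L / l%:R <= L / 2.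
Proof. by rewrite ler_wpM2l ?(ltW L_gt0) // lef_pV2 ?posrE. Qed.

Let N_ge : L / 10 * expR (2 / 5 * L) <= N.
Proof.
rewrite NE; apply: (@le_trans _ _ (expR (L / 10) * expR (2 / 5 * L))).
  rewrite ler_wpM2r ?expR_ge0 //; have := expR_ge1Dx (L / 10); lra.
by rewrite -expRD ler_expR; have := Lw_le; lra.
Qed.

Let N_ge' : L / 10 <= N.
Proof.
apply: le_trans N_ge; have := expR_ge1Dx (2 / 5 * L); have := L_gt0; nra.
Qed.

Let KN_ge : 64 <= K * N.
Proof. have := N_ge'; have := K_gt0; have := KL_ge; nra. Qed.

Let k_lt : K * N < k%:R + 1.
Proof. by case/andP: k_itv => _; rewrite -natr1. Qed.
Let k_le : k%:R <= K * N. Proof. by case/andP: k_itv. Qed.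
Let k_ge : 60 <= k%:R :> R. Proof. have := k_lt; have := KN_ge; lra. Qed.
Let KN_le : K * N <= 2 * k%:R. Proof. have := k_lt; have := k_ge; lra. Qed.
Let cN_le : c * N <= k%:R / 40.
Proof.
have N0 : 0 <= N by rewrite NE expR_ge0.
have := KN_le; have := ler_wpM2r N0 c_le; lra.
Qed.

Let nwN : n%:R = N * w.
Proof. by rewrite nE NE wE -expRD subrK. Qed.
Let w_gt0 : 0 < w. Proof. by rewrite wE expR_gt0. Qed.
Let N_gt0 : 0 < N. Proof. by rewrite NE expR_gt0. Qed.
Let n_gt0 : 0 < n%:R :> R. Proof. by rewrite nE expR_gt0. Qed.

Let ratio_m_le : (18 * m)%:R / n%:R <= expR (- (L / l%:R / 2)).
Proof.
rewrite ler_pdivrMr // nwN natrM wE expRN.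
have -> : expR (L / l%:R) = expR (L / l%:R / 2) * expR (L / l%:R / 2).
  by rewrite -expRD; congr expR; lra.
set s := expR (L / l%:R / 2).
have s0 : 0 < s by exact: expR_gt0.
have -> : s^-1 * (N * (s * s)) = N * s by field; rewrite gt_eqF.
have := L_le_sqrtw; rewrite -/s; case/andP: m_itv => _; have := N_gt0; nra.
Qed.

(** Since k <= K * N and n = N * w, the ratio of the series is at most
n ^ 2 * (12 * K / w) ^ (2 * l) = (12 * K) ^ (2 * l), because w ^ l = n. *)
Lemma first_term_le :
  4 ^+ l * \sum_(1 <= d < k.+1) n%:R ^+ (2 * d) * ((6 * k)%:R / n%:R) ^+ (2 * l * d)
    <= 2 * (12 * K) ^+ 2 :> R.
Proof.
have q0 : 0 <= (12 * K) ^+ 2 by rewrite exprn_ge0 // mulr_ge0 // ltW.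
have q1 : (12 * K) ^+ 2 <= 2^-1.
  by rewrite expr2; have := K_gt0; have := K_le; nra.
apply: le_trans (geometric_sum_le k q0 q1).
rewrite mulr_sumr big_nat [leRHS]big_nat; apply: ler_sum => d /andP[d0 _].
set Y := (6 * k)%:R / n%:R.
have Y0 : 0 <= Y by rewrite divr_ge0 ?ler0n.
have YK : 2 * Y <= 12 * K / w.
  rewrite /Y mulrA ler_pdivrMr // nwN natrM.
  have -> : 12 * K / w * (N * w) = 12 * (K * N) by field; rewrite gt_eqF.
  have := k_le; lra.
have wl : w ^+ l = n%:R.
  by rewrite wE nE -expRM_natr; congr expR; field; rewrite gt_eqF.
have r_le : 4 ^+ l * (n%:R ^+ 2 * Y ^+ (2 * l)) <= (12 * K) ^+ 2.
  apply: (@le_trans _ _ ((12 * K) ^+ (2 * l))); last first.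
    rewrite ler_wiXn2l ?leq_pmulr ?(ltnW l_gt1) ?mulr_ge0 ?(ltW K_gt0) //.
    by have := K_le; lra.
  have -> : 4 = 2 ^+ 2 :> R by rewrite -natrX.
  rewrite -exprM mulrCA -exprMn; apply: (@le_trans _ _ (n%:R ^+ 2 * (12 * K / w) ^+ (2 * l))).
    have Y2_ge0 : 0 <= 2 * Y by rewrite mulr_ge0.
    rewrite ler_wpM2l ?exprn_ge0 ?(ltW n_gt0) // lerXn2r ?nnegrE //.
    exact: le_trans YK.
  rewrite expr_div_n [w ^+ _]exprM exprAC wl mulrC divfK ?exprn_eq0 //.
  by rewrite expf_neq0 // gt_eqF.
apply: (@le_trans _ _ ((4 ^+ l * (n%:R ^+ 2 * Y ^+ (2 * l))) ^+ d)); last first.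
  rewrite lerXn2r ?qualifE //=.
  by rewrite mulr_ge0 ?exprn_ge0 // mulr_ge0 ?exprn_ge0 // ltW.
clearbody Y; rewrite 2!exprMn -!exprM ler_wpM2r ?mulr_ge0 ?exprn_ge0 ?(ltW n_gt0) //.
by rewrite ler_weXn2l // ?leq_pmulr //; lra.
Qed.

Lemma expRNL_le : expR (- L) <= L^-1.
Proof.
rewrite expRN lef_pV2 ?qualifE /= ?expR_gt0 //; have := expR_ge1Dx L; lra.
Qed.

(** Both summands are at most exp (- k L / l): the first because 18 m / n is at
most w^(-1/2), the second because 4^m exceeds |G|/|A| by a factor exp (k L / l).  Raised to
the power l - 1 >= l / 2 this is exp (- k L / 2), which absorbs 8^l and |G|/|A|. *)
Lemma second_term_le :
  4 ^+ l * ((((18 * m)%:R / n%:R) ^+ (2 * k) + g%:R / a%:R / 4 ^+ m) ^+ l.-1 * (g%:R / a%:R))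
    <= L^-1 :> R.
Proof.
apply: le_trans expRNL_le.
set x := expR (- (k%:R * L / l%:R)).
have x0 : 0 < x by exact: expR_gt0.
have X1 : ((18 * m)%:R / n%:R) ^+ (2 * k) <= x.
  apply: (@le_trans _ _ (expR (- (L / l%:R / 2)) ^+ (2 * k))).
    by rewrite lerXn2r ?qualifE /= ?divr_ge0 ?ler0n ?expR_ge0.
  by rewrite -expRM_natr natrM ler_expR; lra.
have X2 : g%:R / a%:R / 4 ^+ m <= x.
  rewrite ler_pdivrMr ?exprn_gt0 //.
  apply: le_trans density_ge _; apply: (@le_trans _ _ (x * expR 1 ^+ m)); last first.
    rewrite ler_wpM2l ?(ltW x0) // lerXn2r ?qualifE /= ?expR_ge0 //.
    by have := expR1_lt3; lra.
  rewrite -expRM_natr -expRD ler_expR.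
  have kl : k%:R * L / l%:R <= k%:R * L.
    rewrite ler_pdivrMr // ler_peMr ?mulr_ge0 ?ler0n ?(ltW L_gt0) //.
    by have := l_ge2; lra.
  have NL0 : 0 < N * L by rewrite mulr_gt0.
  have kL : k%:R * L <= K * (N * L) by rewrite mulrA ler_wpM2r // ltW.
  have := K_le; have := c_le; case/andP: m_itv => + _; rewrite -mulrA; nra.
have X0 : 0 <= ((18 * m)%:R / n%:R) ^+ (2 * k) + g%:R / a%:R / 4 ^+ m :> R.
  by rewrite addr_ge0 ?exprn_ge0 ?divr_ge0 ?ler0n // exprn_ge0.
apply: (@le_trans _ _ (4 ^+ l * ((2 * x) ^+ l.-1 * expR (c * N * L)))).
  rewrite ler_wpM2l ?exprn_ge0 // ler_pM ?exprn_ge0 ?divr_ge0 ?ler0n //.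
  by rewrite lerXn2r ?qualifE /= ?mulr_ge0 ?(ltW x0) //; lra.
have e8 : 4 ^+ l * 2 ^+ l.-1 <= expR (3 * (c * L)).
  apply: (@le_trans _ _ (8 ^+ l)).
    apply: (@le_trans _ _ (4 ^+ l * 2 ^+ l)).
      by rewrite ler_wpM2l ?exprn_ge0 // ler_weXn2l ?leq_pred //; lra.
    by rewrite -exprMn lerXn2r ?qualifE //=; lra.
  apply: (@le_trans _ _ (expR 3 ^+ l)).
    rewrite lerXn2r ?qualifE /= ?expR_ge0 //.
    have -> : 3 = 3%:R * 1 :> R by lra.
    have -> : 8 = 2 ^+ 3 :> R by rewrite -natrX.
    by rewrite expRM_natl lerXn2r ?qualifE /= ?expR_ge0 // expR1_ge2.
  by rewrite -expRM_natr ler_expR; have := l_le_cL; lra.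
have xl : x ^+ l.-1 <= expR (- (k%:R * L / 2)).
  rewrite -expRM_natr ler_expR -mulNr.
  have -> : l.-1%:R = l%:R - 1 :> R by rewrite -subn1 natrB // ltnW.
  have -> : - (k%:R * L) / l%:R * (l%:R - 1) = - (k%:R * L) + k%:R * L / l%:R.
    by field; rewrite gt_eqF.
  have : k%:R * L / l%:R <= k%:R * L / 2.
    rewrite ler_wpM2l ?mulr_ge0 ?ler0n ?(ltW L_gt0) // lef_pV2 ?qualifE //=.
  lra.
have assoc (p q r s : R) : p * ((q * r) * s) = (p * q) * (r * s) by ring.
rewrite exprMn assoc.
apply: (@le_trans _ _ (expR (3 * (c * L)) * (expR (- (k%:R * L / 2)) * expR (c * N * L)))).
  rewrite ler_pM ?mulr_ge0 ?exprn_ge0 ?expR_ge0 ?(ltW x0) //.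
  by rewrite ler_wpM2r ?expR_ge0.
rewrite -!expRD ler_expR.
have h : 3 * c - k%:R / 2 + c * N <= - 1.
  by have := cN_le; have := k_ge; have := c_le; have := K_le; lra.
have := ler_wpM2r (ltW L_gt0) h; lra.
Qed.

(** With t about k / 8 colours, t >= n^(2/5) and (n + 1)^t is at most about
n^(k/4), so the proportion of permutations with more than k cycles is about
n^(k/4 - 2k/5), which is small compared with the square of the density of A. *)
Lemma third_term_le : 4 ^+ l * (g%:R * b%:R / a%:R ^+ 2) ^+ l <= L^-1 :> R.
Proof.
apply: le_trans expRNL_le.
have A0 : 0 < a%:R :> R by rewrite ltr0n.
have G0 : 0 < g%:R :> R by rewrite ltr0n.
pose t := (k %/ 8).+1.
have t_ge : k%:R + 1 <= 8 * t%:R :> R.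
  by rewrite natr1 -natrM ler_nat /t; clear; lia.
have t_le : 8 * t%:R <= k%:R + 8 :> R.
  by rewrite -natrM -natrD ler_nat /t; clear; lia.
have t_exp : expR (2 / 5 * L) <= t%:R.
  have e0 := @expR_gt0 R (2 / 5 * L).
  have := ler_wpM2l (ltW K_gt0) N_ge; have := KL_ge; have := k_lt; have := t_ge.
  nra.
have n1 : n.+1%:R <= expR (2 * L).
  rewrite -natr1 nE expRM_natl expr2; have := expR_ge1Dx L; have := L_ge1; nra.
have bound : b%:R * expR (2 / 5 * L * k.+1%:R) <= 2 * g%:R * expR (2 * L * t%:R).
  apply: (@le_trans _ _ (b%:R * t%:R ^+ k.+1)).
    rewrite ler_wpM2l ?ler0n // expRM_natr lerXn2r ?qualifE /= ?expR_ge0 ?ler0n //.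
  have := b_le t; rewrite -(ler_nat R) !natrM !natrX => h; apply: le_trans h _.
  rewrite ler_wpM2l ?mulr_ge0 ?ler0n // expRM_natr lerXn2r ?qualifE /= ?expR_ge0 ?ler0n //.
have eta_le : 4 * (g%:R * b%:R / a%:R ^+ 2) <= expR (- L).
  have ga0 : 0 <= g%:R / a%:R :> R by rewrite divr_ge0 ?ler0n.
  have ga2 : (g%:R / a%:R) ^+ 2 <= expR (2 * (c * N * L)) :> R.
    by rewrite expRM_natl lerXn2r ?qualifE /= ?expR_ge0.
  have bg : b%:R / g%:R <= 2 * expR (2 * L * t%:R - 2 / 5 * L * k.+1%:R) :> R.
    have assoc (p q r s : R) : p * (q / r) * s = p * s * q / r by ring.
    by rewrite ler_pdivrMr // expRB assoc ler_pdivlMr ?expR_gt0.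
  have -> : 4 * (g%:R * b%:R / a%:R ^+ 2) = 4 * (b%:R / g%:R * (g%:R / a%:R) ^+ 2) :> R.
    by field; rewrite !gt_eqF.
  apply: (@le_trans _ _ (4 * (2 * expR (2 * L * t%:R - 2 / 5 * L * k.+1%:R) * expR (2 * (c * N * L))))).
    by rewrite ler_wpM2l // ler_pM ?exprn_ge0 ?divr_ge0 ?ler0n.
  have e8 : 8 <= expR 3 :> R.
    have -> : 3 = 3%:R * 1 :> R by lra.
    have -> : 8 = 2 ^+ 3 :> R by rewrite -natrX.
    by rewrite expRM_natl lerXn2r ?qualifE /= ?expR_ge0 // expR1_ge2.
  rewrite -mulrA -expRD mulrA.
  apply: (@le_trans _ _ (expR 3 * expR (2 * L * t%:R - 2 / 5 * L * k.+1%:R + 2 * (c * N * L)))).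
    by rewrite ler_wpM2r ?expR_ge0 //; lra.
  rewrite -expRD ler_expR -natr1.
  have h : 2 * t%:R - 2 / 5 * (k%:R + 1) + 2 * (c * N) <= - 2.
    by have := cN_le; have := k_ge; have := t_le; lra.
  have := ler_wpM2r (ltW L_gt0) h; have := L_ge1; lra.
have eta0 : 0 <= 4 * (g%:R * b%:R / a%:R ^+ 2) :> R.
  by rewrite mulr_ge0 // divr_ge0 ?mulr_ge0 ?exprn_ge0 ?ler0n.
rewrite -exprMn; apply: le_trans (eta_le).
rewrite -[leRHS]expr1 ler_wiXn2l ?(ltnW l_gt1) //.
apply: le_trans eta_le _; rewrite -expR0 ler_expR; have := L_gt0; lra.
Qed.

Lemma dist_bound_le : dist_bound R n k l m g a b <= 2 * (12 * K) ^+ 2 + 2 / L.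
Proof.
rewrite /dist_bound !mulrDr.
have := first_term_le; have := second_term_le; have := third_term_le; lra.
Qed.

Lemma size_conditions : [/\ (k + 2 <= n)%N, (18 * m <= n)%N & (12 * m + 4 <= n)%N].
Proof.
have m18 : (18 * m <= n)%N.
  rewrite -(ler_nat R) -[leRHS]mul1r -ler_pdivrMr //.
  apply: le_trans ratio_m_le _; rewrite expR_le1 oppr_le0.
  by rewrite !divr_ge0 ?ler0n // ltW.
have m1 : (0 < m)%N.
  rewrite -(ltr0n R); case/andP: m_itv => h _; apply: lt_le_trans h.
  by rewrite mulr_gt0.
have k18 : (k + 2 <= n)%N.
  rewrite -(ler_nat R) natrD; have : (18 * m)%:R <= n%:R :> R by rewrite ler_nat.
  rewrite natrM; case/andP: m_itv => h _; have := k_le; have := K_le; have := L_ge1; have := N_ge'.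
  nra.
by split=> //; move: m18 m1; clear; lia.
Qed.

End Asymptotics.

(** * Mixing of the random walk *)

Lemma mixes_at_sq_dist (R : realType) (gT : finGroupType) (G : {group gT})
    (A : {set gT}) (eps : R) l : 0 < eps ->
  sq_dist G A R l < eps ^+ 2 -> mixes_at G eps 2 A l.
Proof.
move=> eps_gt0 lt_eps; rewrite /mixes_at /lp_norm.
have -> : expectation G (fun s => `|conv_power G (normalized_indicator R G A) l s - 1| `^ 2) =
    sq_dist G A R l.
  rewrite /expectation /sq_dist; congr (_ / _); apply: eq_bigr => s Gs.
  by rewrite powR_mulrn // real_normK ?num_real.
rewrite powR12_sqrt; last first.
  by rewrite divr_ge0 ?ler0n // sumr_ge0 // => s _; rewrite sqr_ge0.
by rewrite -[ltRHS]gtr0_norm // -sqrtr_sqr ltr_sqrt // exprn_gt0.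
Qed.

Lemma mixing_time_exists (R : realType) (gT : finGroupType) (G : {group gT})
    (A : {set gT}) (eps p : R) l : (0 < l)%N -> mixes_at G eps p A l ->
  exists2 m : nat, is_mixing_time G eps p A m & (m <= l)%N.
Proof.
move=> l_gt0 mix_l.
pose P k := (0 < k)%N &&
  (lp_norm G p (fun s => conv_power G (normalized_indicator R G A) k s - 1) < eps).
have PP k : (0 < k)%N -> mixes_at G eps p A k -> P k by rewrite /P => -> /=.
have exP : exists k, P k by exists l; exact: PP.
case: (ex_minnP exP) => m /andP[m_gt0 mix_m] min_m; exists m.
  by split=> // k k_gt0 mix_k; exact: min_m (PP k k_gt0 mix_k).
exact: min_m (PP l l_gt0 mix_l).
Qed.

Lemma sq_dist_real_le (R : realType) n k l m (A : {set 'S_n}) :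
  (A <| 'Alt_('I_n))%g -> A != set0 -> (0 < l)%N ->
  (k + 2 <= n)%N -> (18 * m <= n)%N -> (12 * m + 4 <= n)%N ->
  sq_dist ('Alt_('I_n))%G A R l <=
    dist_bound R n k l m #|('Alt_('I_n))%g| #|A| #|[set x in A | (k < #|porbits x|)%N]|.
Proof.
move=> nA A0 l0 h1 h2 h3.
have := @sq_dist_le 'I_n A k l m nA A0 l0; rewrite card_ord => /(_ h1 h2 h3).
rewrite (sq_dist_rmorph _ _ (ratr : {rmorphism rat -> algC})).
rewrite (dist_bound_rmorph (ratr : {rmorphism rat -> algC})) ler_rat => le_rat.
by rewrite (sq_dist_rmorph _ _ (ratr : {rmorphism rat -> R}))
  (dist_bound_rmorph (ratr : {rmorphism rat -> R})) ler_rat.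
Qed.

Lemma normal_subset_normal (gT : finGroupType) (G : {group gT}) (A : {set gT}) :
  normal_subset G A -> (A <| G)%g.
Proof.
case=> sAG clA; apply/andP; split=> //; apply/subsetP => g Gg; rewrite inE.
by apply/subsetP => _ /imsetP[x xA ->]; apply: clA.
Qed.

Theorem theorem1p4 (R : realType) (eps : R) (eps_gt0 : 0 < eps) :
  exists c : R, 0 < c /\
    forall (n l : nat) (A : {set 'S_n}),
      (1 < l)%N ->
      l%:R < c * ln n%:R / ln (ln n%:R) ->
      normal_subset ('Alt_('I_n))%G A ->
      n%:R `^ (- (c * n%:R `^ (1 - l%:R^-1))) <= density R ('Alt_('I_n))%G A ->
      exists2 m : nat, is_mixing_time ('Alt_('I_n))%G eps 2 A m & (m <= l)%N.
Proof.
pose e := Num.min 1 eps; pose K : R := e / 48; pose kap : R := ln (ln 3).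
have e_gt0 : 0 < e by rewrite lt_min ltr01 eps_gt0.
have e_le1 : e <= 1 by rewrite ge_min lexx.
have e_le : e <= eps by rewrite ge_min lexx orbT.
have K_gt0 : 0 < K by rewrite divr_gt0.
have K_le : K <= 48^-1 by rewrite /K; lra.
have ln3 : 1 < ln 3 :> R by rewrite -ltr_expR lnK ?posrE // expR1_lt3.
have kap_gt0 : 0 < kap by exact: ln_gt0.
pose c : R := Num.min (K / 80) (kap * K ^+ 2 / 64).
have c_gt0 : 0 < c by rewrite lt_min !divr_gt0 // mulr_gt0 // exprn_gt0.
have c_le : c <= K / 80 by rewrite ge_min lexx.
have c_le' : c <= kap * K ^+ 2 / 64 by rewrite ge_min lexx orbT.
exists c; split=> // n l A l_gt1 lt_l nsA dens.
have nA := normal_subset_normal nsA.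
have l_ge2 : 2 <= l%:R :> R by rewrite ler_nat.
(* For n <= 2 the upper bound on l is not positive. *)
have n_ge3 : (2 < n)%N.
  case: n A lt_l {nsA nA dens} => [|[|[|n]]] // A.
  - by rewrite ln0 // mulr0 mul0r; lra.
  - by rewrite ln1 mulr0 mul0r; lra.
  have ln2_gt0 : 0 < ln 2 :> R by rewrite ln_gt0 // ltr1n.
  have ln2_lt1 : ln 2 < 1 :> R.
    by rewrite -ltr_expR lnK ?posrE //; have := @expR_gt1Dx R 1 (oner_neq0 _); lra.
  have lnln2 : ln (ln 2) < 0 :> R by rewrite ln_lt0 // ln2_gt0.
  have : c * ln 2 / ln (ln 2) <= 0.
    by rewrite mulr_ge0_le0 ?invr_le0 ?(ltW lnln2) // mulr_ge0 // ltW.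
  lra.
set L : R := ln n%:R in lt_l.
have n_gt0 : 0 < n%:R :> R by rewrite ltr0n ltnW // ltnW.
have L_gt1 : 1 < L.
  apply: lt_le_trans ln3 _; rewrite -ler_expR !lnK ?posrE //.
  by rewrite ler_nat.
have lnL : kap <= ln L.
  rewrite -ler_expR !lnK ?posrE ?(lt_trans ltr01) //.
  by rewrite -ler_expR !lnK ?posrE // ler_nat.
have l_lnL : l%:R * ln L < c * L.
  by rewrite -ltr_pdivlMr // (lt_le_trans kap_gt0).
(* As ln L stays above kap > 0, the bound 2 <= l makes L at least 2 * kap / c. *)
have L_ge : 128 <= K ^+ 2 * L.
  have h1 : 2 * kap < c * L by apply: le_lt_trans l_lnL; rewrite ler_pM // ltW.
  have h2 : c * L <= kap * K ^+ 2 / 64 * L by rewrite ler_wpM2r // ltW // (lt_trans ltr01).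
  have h3 : kap * 128 < kap * (K ^+ 2 * L) by lra.
  by apply: ltW; rewrite -(ltr_pM2l kap_gt0).
pose w := expR (L / l%:R); pose N := expR (L - L / l%:R).
have nE : n%:R = expR L by rewrite lnK.
have NE : n%:R `^ (1 - l%:R^-1) = N.
  by rewrite /powR gt_eqF // -/L /N; congr expR; ring.
have l_gt0 : (0 < l)%N by exact: ltnW.
have l_pos : 0 < l%:R :> R by rewrite ltr0n.
have N_ge1 : 1 <= N.
  rewrite -expR0 ler_expR subr_ge0 ler_pdivrMr //; nra.
have A_neq0 : A != set0.
  apply: contraTneq dens => ->; rewrite /density cards0 mul0r -ltNge.
  exact: powR_gt0.
have a_gt0 : (0 < #|A|)%N by rewrite card_gt0.
set g := #|('Alt_('I_n))%g|; have g_gt0 : (0 < g)%N by exact: cardG_gt0.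
have dens' : g%:R / #|A|%:R <= expR (c * N * L).
  rewrite NE /powR gt_eqF // -/L mulNr expRN in dens.
  rewrite -[leLHS]invrK invf_div -[leRHS]invrK lef_pV2 ?posrE ?invr_gt0 ?expR_gt0 //.
  by rewrite divr_gt0 // ltr0n.
pose k := Num.truncn (K * N); pose m := (Num.truncn (N * L)).+1.
have KN_ge0 : 0 <= K * N by rewrite mulr_ge0 ?expR_ge0 // ltW.
have k_itv : k%:R <= K * N < k.+1%:R by exact: truncn_itv.
have m_itv : N * L <= m%:R <= 2 * (N * L).
  have NL_ge1 : 1 <= N * L by nra.
  have /andP[h1 h2] := truncn_itv (le_trans ler01 NL_ge1).
  rewrite -natr1 in h2; rewrite /m -natr1; apply/andP; split; lra.
pose b := #|[set x in A | (k < #|porbits x|)%N]|.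
have b_le t : (b * t ^ k.+1 <= 2 * g * n.+1 ^ t)%N.
  have -> : (2 * g = n`!)%N by rewrite /g card_Alt card_ord // ltnW.
  apply: leq_trans (count_many_cycles n t k); rewrite leq_mul2r; apply/orP; right.
  by apply/subset_leq_card/subsetP => x; rewrite !inE => /andP[].
have [] := @size_conditions R L N w K c n l k m => // k_n m_n m_n'.
apply: mixing_time_exists => //; apply: mixes_at_sq_dist => //.
apply: le_lt_trans (sq_dist_real_le R nA A_neq0 l_gt0 k_n m_n m_n') _.
have := @dist_bound_le R L N w K c n l k m g #|A| b.
move=> /(_ l_gt1 K_gt0 K_le L_ge nE erefl erefl c_le l_lnL k_itv m_itv a_gt0 g_gt0 dens' b_le).
move=> h; apply: le_lt_trans h _.
have L_pos : 0 < L by lra.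
have h1 : 2 / L <= K ^+ 2 / 64.
  by rewrite ler_pdivrMr //; lra.
have h2 : 2 * (12 * K) ^+ 2 + K ^+ 2 / 64 < e ^+ 2.
  have -> : e = 48 * K by rewrite /K; field.
  have : 0 < K ^+ 2 by rewrite exprn_gt0.
  rewrite !expr2; lra.
have h3 : e ^+ 2 <= eps ^+ 2 by rewrite lerXn2r ?nnegrE // ltW.
lra.
Qed.
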